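(* Let $\mathbf{k}$ be a field, let $k\geq 1$ be an integer, and let $f$ be a birational transformation of the projective space $\mathbb{P}^k_{\mathbf{k}}$ of degree $d$. If the sequence $\left(\max_{0\leq j\leq n}\deg(f^j)\right)_{n\geq 0}$ is unbounded, then it is bounded from below by the sequence of integers $(\chi_{d,k}(n))_{n\geq 0}$; that is, $$\max_{0\leq j\leq n}\deg(f^j)\geq \chi_{d,k}(n)\quad\text{for all } n\geq 0.$$
   Context: The degree $\deg(g)$ of a birational transformation $g$ of $\mathbb{P}^k_{\mathbf{k}}$ is the degree of the homogeneous polynomials without common factor that define $g$ in homogeneous coordinates; $f^j$ is the $j$-th iterate of $f$. Definition of $\chi_{d,k}$. Fix positive integers $k$ and $d$ and set $m=(d-1)(k+1)$. For an integer $D\geq 1$ set $q=(dD+1)^m$ and $\Phi(c)=qc^2$ for every positive integer $c$. Define positive integers $(F_i)_{i\geq 1}$ recursively by $F_1=q(D+1)^2$ and $F_{i+1}=\Phi^{F_i}(F_i)$, where $\Phi^{F_i}$ denotes the $F_i$-th iterate of the function $\Phi$. Set $S(j)=1+F_1+F_2+\cdots+F_j$ for $j\geq 0$ (so $S(0)=1$). The quantities $q,\Phi,F_i,S$ depend on $d$, $k$ and $D$; write $S=S_D$ to stress the dependence on $D$. Then $$\chi_{d,k}(n)=\max\left\{D\;\middle|\; S_D\left(\binom{k+D}{k}-2\right)<n\right\},$$ where the maximum is taken over the integers $D\geq 1$ satisfying the inequality, and $\chi_{d,k}(n)=0$ if there is no such $D$. *)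

(* Defs.v *)
From Stdlib Require Import ClassicalEpsilon.
From HB Require Import structures.
From mathcomp Require Import all_boot all_order all_algebra.
From mathcomp Require Import mpoly.

Set Implicit Arguments.
Unset Strict Implicit.
Unset Printing Implicit Defensive.

Import GRing.Theory.
Local Open Scope ring_scope.

(* A rational self-map of P^k is handled through its systems of homogeneous
   coordinates; two systems define the same map iff they are proportional. *)

Definition coords (K : fieldType) (k : nat) : Type :=
  (k.+1).-tuple {mpoly K[k.+1]}.

Definition homog_coords (K : fieldType) (k e : nat) (F : coords K k) : Prop :=
  (exists i, tnth F i != 0) /\ (forall i, tnth F i \is e.-homog).

Definition rational_coords (K : fieldType) (k : nat) (F : coords K k) : Prop :=
  exists e, homog_coords e F.

(* Equality in P^k over the function field; only an equivalence relation on
   coordinate systems that are not identically zero. *)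
Definition same_map (K : fieldType) (k : nat) (F G : coords K k) : Prop :=
  forall i j, tnth F i * tnth G j = tnth F j * tnth G i.

Definition no_common_factor (K : fieldType) (k : nat) (F : coords K k) : Prop :=
  forall h : {mpoly K[k.+1]},
    (forall i, exists q : {mpoly K[k.+1]}, tnth F i = q * h) -> h \is a GRing.unit.

Definition id_coords (K : fieldType) (k : nat) : coords K k :=
  [tuple 'X_i | i < k.+1].

(* F after G, common factors being kept. *)
Definition comp_coords (K : fieldType) (k : nat) (F G : coords K k) :
    coords K k :=
  [tuple tnth F i \mPo G | i < k.+1].

(* The composites are required to be rational_coords because they could
   vanish identically, in which case the composed map is undefined. *)
Definition birational (K : fieldType) (k : nat) (F : coords K k) : Prop :=
  rational_coords F /\
  exists G : coords K k,
    [/\ rational_coords G,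
        rational_coords (comp_coords F G),
        rational_coords (comp_coords G F),
        same_map (comp_coords F G) (id_coords K k)
      & same_map (comp_coords G F) (id_coords K k)].

Definition iterate (K : fieldType) (k : nat) (F : coords K k) (j : nat) :
    coords K k :=
  iter j (comp_coords F) (id_coords K k).

Definition has_degree (K : fieldType) (k : nat) (F : coords K k) (e : nat) :
    Prop :=
  exists G : coords K k,
    [/\ homog_coords e G, no_common_factor G & same_map F G].

(* The degree of the map defined by F, not of the polynomials in F: see
   has_degree_degree. *)
Definition degree (K : fieldType) (k : nat) (F : coords K k) : nat :=
  epsilon (inhabits 0%N) (has_degree F).

Definition max_degree (K : fieldType) (k : nat) (F : coords K k) (n : nat) :
    nat :=
  (\max_(j < n.+1) degree (iterate F j))%N.

Section Chi.
Local Open Scope nat_scope.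

Definition chi_q (d k D : nat) : nat := (d * D + 1) ^ ((d - 1) * (k + 1)).

Definition chi_Phi (d k D c : nat) : nat := chi_q d k D * c ^ 2.

(* Indices are shifted: chi_F d k D i is F_(i+1). *)
Fixpoint chi_F (d k D i : nat) : nat :=
  if i is i'.+1 then
    iter (chi_F d k D i') (chi_Phi d k D) (chi_F d k D i')
  else chi_q d k D * (D + 1) ^ 2.

Definition chi_S (d k D j : nat) : nat := 1 + \sum_(i < j) chi_F d k D i.

Definition chi_adm (d k n D : nat) : bool :=
  (0 < D) && (chi_S d k D ('C(k + D, k) - 2) < n).

(* For k > 0 the bound D < n loses nothing: see chi_max. *)
Definition chi (d k n : nat) : nat := \max_(D < n | chi_adm d k n D) D.

Lemma chi_q_gt0 d k D : 0 < chi_q d k D.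
Proof. by rewrite /chi_q expn_gt0 addn1. Qed.

Lemma chi_F_gt0 d k D i : 0 < chi_F d k D i.
Proof.
elim: i => [|i IH] /=; first by rewrite muln_gt0 chi_q_gt0 expn_gt0 addn1.
elim: {1}(chi_F d k D i) => //= m IHm.
by rewrite muln_gt0 chi_q_gt0 expn_gt0 IHm.
Qed.

Lemma chi_adm_lt d k n D : 0 < k -> chi_adm d k n D -> D < n.
Proof.
case: k => // k _ /andP[D0]; apply: leq_ltn_trans.
have hb m : m < 'C(k.+1 + m, k.+1).
  elim: m => [|m IH]; first by rewrite addn0 binn.
  rewrite addnS binS -addn1; apply: leq_add => //.
  by rewrite bin_gt0 addSnnS leq_addr.
have hS j : j < chi_S d k.+1 D j.
  rewrite /chi_S addnC addn1 ltnS -[X in X <= _]card_ord -sum1_card.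
  by apply: leq_sum => i _; exact: chi_F_gt0.
apply: leq_trans (hS _).
have := leq_sub2r 2 (hb D); rewrite subSS subn1.
by rewrite -ltnS prednK.
Qed.

Lemma chi_max d k n : 0 < k ->
  (forall D, chi_adm d k n D -> D <= chi d k n) /\
  (chi_adm d k n (chi d k n) \/
   chi d k n = 0 /\ forall D, ~~ chi_adm d k n D).
Proof.
move=> k0; have le D : chi_adm d k n D -> D <= chi d k n.
  by move=> hD; exact: (leq_bigmax_cond (Ordinal (chi_adm_lt k0 hD)) hD).
split=> //; have: chi_adm d k n (chi d k n) \/ chi d k n = 0.
  rewrite /chi; elim/big_rec: _ => [|D x hD IH]; first by right.
  by rewrite /maxn; case: ifP => _; [exact: IH | left].
case=> [|c0]; [by left | right; split=> // D].
by apply/negP => hD; have := le D hD; rewrite c0 leqNgt; case/andP: hD => ->.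
Qed.

End Chi.

Section DegreeIsDefined.
Variables (K : fieldType) (k : nat).
Implicit Types (F G H : coords K k) (p q : {mpoly K[k.+1]}).

Lemma pihomog_top a b p q : (msize p <= a.+1)%N -> (msize q <= b.+1)%N ->
  pihomog mdeg (a + b) (p * q) = pihomog mdeg a p * pihomog mdeg b q.
Proof.
move=> hp hq.
rewrite {1}(pihomog_partitionE hp) {1}(pihomog_partitionE hq).
have hom i j : pihomog mdeg i p * pihomog mdeg j q \is (i + j).-homog.
  by rewrite dhomogM // pihomogP.
rewrite mulr_suml raddf_sum big_ord_recr /= big1 ?add0r => [|i _].
  rewrite mulr_sumr raddf_sum big_ord_recr /= big1 ?add0r => [|j _].
    exact/pihomog_dE.
  by apply: pihomog_ne0 (hom _ _); rewrite eqn_add2l neq_ltn ltn_ord.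
rewrite mulr_sumr raddf_sum big1 // => j _; apply: pihomog_ne0 (hom _ _).
have hj : (j <= b)%N by rewrite -ltnS.
by rewrite neq_ltn -addSn leq_add.
Qed.

Lemma has_degree_ex F : rational_coords F -> exists e, has_degree F e.
Proof.
case=> e0 hF; suff main : forall n e G, (e < n)%N -> homog_coords e G ->
    same_map F G -> exists e', has_degree F e'.
  by apply: (main e0.+1 e0 F) => // i j; rewrite mulrC.
elim=> // n IH e G len hG sFG.
case: (classic (no_common_factor G)) => [cG|]; first by exists e, G.
move=> /not_all_ex_not[h hh]; have [dG /negP hu] := imply_to_and _ _ hh.
have [[i0 hi0] homG] := hG.
pose q i := proj1_sig (constructive_indefinite_description _ (dG i)).
have qE i : tnth G i = q i * h by rewrite /q; case: constructive_indefinite_description.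
have h0 : h != 0 by apply: contraNneq hi0 => h0; rewrite qE h0 mulr0.
have sh : (1 < msize h)%N.
  rewrite ltnNge; apply: contra hu => /msize1_polyC hE.
  move: h0; rewrite hE mpolyC_eq0 => c0.
  by apply/unitrP; exists ((h@_0)^-1)%:MP; rewrite -!mpolyCM mulVf ?mulfV.
have szG i : q i != 0 -> (msize (q i) + (msize h).-1 = e.+1)%N.
  move=> qi0; have Gi0 : tnth G i != 0 by rewrite qE mulf_neq0.
  have := mlead_supp Gi0 => /(elimT (dhomogP _ _ _) (homG i)) eE.
  have := mlead_deg Gi0; rewrite eE qE msizeM // => ->.
  by case: (msize h) sh => // s _; rewrite addnS.
have qi0 : q i0 != 0 by apply: contraNneq hi0 => q0; rewrite qE q0 mul0r.
have := szG _ qi0; set b := (msize h).-1 => se.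
have b0 : (0 < b)%N by rewrite /b -ltnS prednK // ltnW.
have sq0 : (0 < msize (q i0))%N by rewrite lt0n mmeasure_poly_eq0.
pose a := (msize (q i0)).-1.
have ae : (a + b = e)%N.
  by apply: succn_inj; rewrite -se -addSn prednK.
have szq i : (msize (q i) <= a.+1)%N.
  have [->|qi] := eqVneq (q i) 0; first by rewrite mmeasure0.
  have := szG _ qi; rewrite -se => /addIn ->; by rewrite prednK.
have GE i : tnth G i = pihomog mdeg a (q i) * pihomog mdeg b h.
  rewrite -pihomog_top ?szq // ?ae -?qE ?pihomog_dE //.
  by rewrite /b prednK // ltnW.
pose G' : coords K k := [tuple pihomog mdeg a (q i) | i < k.+1].
have hb0 : pihomog mdeg b h != 0.
  by apply: contraNneq hi0 => hb; rewrite GE hb mulr0.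
apply: (IH a G').
- by rewrite -ltnS; apply: leq_trans len; rewrite ltnS -ae -addn1 leq_add2l.
- split=> [|i]; last by rewrite tnth_mktuple pihomogP.
  exists i0; rewrite tnth_mktuple; apply: contraNneq hi0 => z.
  by rewrite GE z mul0r.
- move=> i j; rewrite !tnth_mktuple; apply: (mulIf hb0).
  by rewrite -!mulrA -!GE sFG.
Qed.

Lemma has_degree_degree F : rational_coords F -> has_degree F (degree F).
Proof. by move=> /has_degree_ex; exact: epsilon_spec. Qed.

Lemma comp_mpolyA p F G : (p \mPo F) \mPo G = p \mPo comp_coords F G.
Proof.
rewrite (comp_mpolyEX p F) (comp_mpolyEX p (comp_coords F G)) raddf_sum.
apply: eq_bigr => m _; rewrite /= comp_mpolyZ; congr (_ *: _).
rewrite !comp_mpolyX rmorph_prod; apply: eq_bigr => i _.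
by rewrite rmorphXn tnth_mktuple.
Qed.

Lemma comp_mpoly_homog r e p F : p \is r.-homog ->
  (forall i, tnth F i \is e.-homog) -> p \mPo F \is (r * e).-homog.
Proof.
move=> hp hF; rewrite comp_mpolyEX big_seq rpred_sum // => m mp.
have <- : mdeg m = r := elimT (dhomogP _ _ _) hp _ mp.
rewrite dhomogZ // comp_mpolyX mdegE big_distrl /=.
elim/big_rec2: _ => [|i x y _ IH]; first exact: dhomog1.
by apply: dhomogM => //; rewrite mulnC; exact: dhomogMn.
Qed.

Lemma comp_mpoly_scale r p F c : p \is r.-homog ->
  p \mPo [tuple c * tnth F i | i < k.+1] = c ^+ r * (p \mPo F).
Proof.
move=> hp; rewrite !comp_mpolyEX mulr_sumr !big_seq.
apply: eq_bigr => m mp; rewrite -scalerAr !comp_mpolyX; congr (_ *: _).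
have <- : mdeg m = r := elimT (dhomogP _ _ _) hp _ mp.
rewrite mdegE -prodrXr -big_split /=.
by apply: eq_bigr => i _; rewrite tnth_mktuple exprMn.
Qed.

Lemma comp_birational_neq0 r p F : birational F -> p \is r.-homog -> p != 0 ->
  p \mPo F != 0.
Proof.
case=> _ [G [_ [e [[i0 hi0] _]] _ sFG _]] hp p0.
set C := comp_coords F G in hi0 sFG.
apply: contraNneq p0 => pF.
have pC : p \mPo C = 0 by rewrite -comp_mpolyA pF comp_mpoly0.
have E : [tuple 'X_i0 * tnth C i | i < k.+1] =
         [tuple tnth C i0 * tnth (id_coords K k) i | i < k.+1].
  apply: eq_from_tnth => i; rewrite !tnth_mktuple mulrC.
  by have := sFG i i0; rewrite !tnth_mktuple.
have := comp_mpoly_scale C 'X_i0 hp; rewrite E (comp_mpoly_scale _ _ hp) pC mulr0.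
by rewrite comp_mpoly_id => /eqP; rewrite mulf_eq0 expf_eq0 (negPf hi0) andbF.
Qed.

Lemma iterateSr F j : iterate F j.+1 = comp_coords (iterate F j) F.
Proof.
have asc (A B C : coords K k) : comp_coords (comp_coords A B) C =
    comp_coords A (comp_coords B C).
  by apply: eq_from_tnth => i; rewrite !tnth_mktuple comp_mpolyA.
elim: j => [|j IH].
  apply: eq_from_tnth => i; rewrite !tnth_mktuple comp_mpoly_id.
  by rewrite comp_mpolyXU -tnth_nth.
by rewrite -[LHS]/(comp_coords F (iterate F j.+1)) [in LHS]IH -asc.
Qed.

Lemma rational_iterate F j : birational F -> rational_coords (iterate F j).
Proof.
move=> bF; elim: j => [|j [e [[i hi] he]]].
  exists 1%N; split=> [|i]; last by rewrite tnth_mktuple dhomogX; apply/eqP/mdeg1.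
  exists ord0; rewrite tnth_mktuple; apply/eqP => /(congr1 (mcoeff U_(ord0))).
  by rewrite mcoeffX eqxx mcoeff0 => /eqP; rewrite oner_eq0.
have [[e' [_ he']] _] := bF; exists (e * e')%N; rewrite iterateSr; split=> [|l].
  by exists i; rewrite tnth_mktuple; exact: comp_birational_neq0 (he i) hi.
by rewrite tnth_mktuple; exact: comp_mpoly_homog.
Qed.

End DegreeIsDefined.

(* Main.v *)
Require Import Defs.
From Stdlib Require Import ClassicalEpsilon.
From HB Require Import structures.
From mathcomp Require Import all_boot all_order all_algebra.
From mathcomp Require Import mpoly zify ring.

Set Implicit Arguments.
Unset Strict Implicit.
Unset Printing Implicit Defensive.

Import GRing.Theory.
Local Open Scope ring_scope.

(* Suppose that deg(f^j) < D for all j <= n. Write P_j for reduced coordinates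
   of f^j and F for those of f, so that P_j o F = h_j P_{j+1}. If G is the
   inverse of F and G o F = H x, then h_j divides H^(dD), so the h_j, together
   with the degrees of the P_j, form a word over an alphabet whose size depends
   only on d, k and D. Attach to a word w the span X_w of the coordinates of all
   P_i such that w occurs at position i. A long word contains sesquipowers
   w_0, w_1 = w_0 v w_0, w_2 = w_1 v' w_1, ..., whose spans decrease inside a
   space of homogeneous polynomials of degree less than D; hence two
   consecutive ones coincide, say X_{w v w} = X_w. Then composing with F^t, for
   t = |w v|, maps X_w into h X_w for some h, so the degrees of f^(i + s t) stay
   below D for all s, and the whole sequence of degrees is bounded. *)

(** * Unique factorization of multivariate polynomials *)

Lemma ex_least (P : nat -> Prop) :
  (exists n, P n) -> exists2 n, P n & forall m, P m -> (n <= m)%N.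
Proof.
case=> n; elim/ltn_ind: n => n IH Pn.
case: (classic (exists2 m, P m & (m < n)%N)) => [[m Pm lt]|nex].
  exact: IH lt Pm.
exists n => // m Pm; rewrite leqNgt; apply/negP => lt.
by apply: nex; exists m.
Qed.

Section Divisibility.
Variable R : idomainType.
Implicit Types (a b c p q u : R) (s : seq R).

Definition divides a b : Prop := exists q, b = q * a.

Definition prime_elt p : Prop :=
  [/\ p != 0, p \isn't a GRing.unit
    & forall a b, divides p (a * b) -> divides p a \/ divides p b].

Definition prime_factors a s : Prop :=
  (forall p, p \in s -> prime_elt p) /\
  exists2 u, u \is a GRing.unit & a = u * \prod_(p <- s) p.

(** Factors are required to be prime, not merely irreducible, so that existence of a factorization
    already carries uniqueness. *)
Definition factorial_ring : Prop :=
  forall a, a != 0 -> exists s, prime_factors a s.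

Lemma divides_trans b a c : divides a b -> divides b c -> divides a c.
Proof. by case=> q -> [r ->]; exists (r * q); rewrite mulrA. Qed.

Lemma prime_factors_cat a b s t :
  prime_factors a s -> prime_factors b t -> prime_factors (a * b) (s ++ t).
Proof.
case=> ps [u uu ->] [pt [v uv ->]]; split.
  by move=> p; rewrite mem_cat => /orP[/ps|/pt].
by exists (u * v); rewrite ?unitrM ?uu ?uv // big_cat /= mulrACA.
Qed.

(** Each prime of the list divides one of the two factors, and a Boolean mask records which. Such
    masks later serve as a finite code for the cofactors h_j. *)
Lemma prime_factors_split a b s : prime_factors (a * b) s ->
  exists m, [/\ size m = size s, prime_factors a (mask m s)
              & prime_factors b (mask (map negb m) s)].
Proof.
elim: s a b => [|p s IH] a b [ps [u uu E]].
  exists [::]; split=> //; split=> //; rewrite ?big_nil.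
    exists a; rewrite ?mulr1 //.
    by move: uu; rewrite -[u]mulr1 -(big_nil 1 *%R xpredT id) -E unitrM;
       case/andP.
  exists b; rewrite ?mulr1 //.
  by move: uu; rewrite -[u]mulr1 -(big_nil 1 *%R xpredT id) -E unitrM;
     case/andP.
have [p0 pu pP] := ps p (mem_head _ _).
have ps' q : q \in s -> prime_elt q.
  by move=> qs; apply: ps; rewrite inE qs orbT.
have cons_mask c m : prime_factors c (mask m s) ->
    prime_factors (c * p) (p :: mask m s).
  case=> pm [v uv ->]; split=> [q|]; first by rewrite inE => /orP[/eqP->|/pm].
  by exists v; rewrite // big_cons mulrAC mulrA.
have: divides p (a * b).
  by exists (u * \prod_(q <- s) q); rewrite E big_cons mulrCA mulrC.
case/pP=> -[c cE].
  have [|m [sm hc hb]] := IH c b.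
    split=> //; exists u => //; apply: (mulIf p0).
    by rewrite mulrAC -cE E big_cons mulrCA mulrC.
  exists (true :: m); rewrite /= sm; split=> //.
  by rewrite cE; exact: cons_mask.
have [|m [sm hc hb]] := IH a c.
  split=> //; exists u => //; apply: (mulIf p0).
  by rewrite -mulrA -cE E big_cons mulrCA mulrC.
exists (false :: m); rewrite /= sm; split=> //.
by rewrite cE; exact: cons_mask.
Qed.

Lemma prime_factors_nil a : prime_factors a [::] -> a \is a GRing.unit.
Proof. by case=> _ [u uu ->]; rewrite big_nil mulr1. Qed.

End Divisibility.

Section PolyFactorial.
Variable R : idomainType.
Implicit Types (c p : R) (f g t : {poly R}).

Lemma dividesC_coef p f :
  divides p%:P f <-> forall i, divides p f`_i.
Proof.
split=> [[q ->] i|hf]; first by exists q`_i; rewrite coefMC.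
pose c i := proj1_sig (constructive_indefinite_description _ (hf i)).
have cE i : f`_i = c i * p.
  by rewrite /c; case: constructive_indefinite_description.
exists (\poly_(i < size f) c i); apply/polyP => i.
rewrite coefMC coef_poly; case: ltnP => [_|le]; first exact: cE.
by rewrite nth_default // mul0r.
Qed.


(** Gauss's lemma, by induction on the sum of the sizes. The product of the constant coefficients is
    divisible by p, hence so is one of them; dropping it and dividing by X shortens that
    polynomial. *)
Lemma prime_polyC p : prime_elt p -> prime_elt p%:P.
Proof.
case=> p0 pu pP; split=> [||a b].
- by rewrite polyC_eq0.
- by rewrite poly_unitE coefC eqxx negb_and pu orbT.
have step f g c : divides p c ->
    divides p%:P ((f * 'X + c%:P) * g) -> divides p%:P (f * g).
  move=> [e ->] [q E]; apply/dividesC_coef => i.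
  have /dividesC_coef/(_ i.+1): divides p%:P (f * g * 'X).
    exists (q - e%:P * g); rewrite mulrBl -E polyCM mulrDl [f * 'X * g]mulrAC.
    by rewrite [e%:P * p%:P * g]mulrAC addrK.
  by rewrite coefMX.
have [n] := ubnP (size a + size b); elim: n a b => // n IH a b.
have [-> _ _|a0] := eqVneq a 0; first by left; exists 0; rewrite mul0r.
have [-> _ _|b0] := eqVneq b 0; first by right; exists 0; rewrite mul0r.
elim/poly_ind: a a0 => [|a c _]; rewrite ?eqxx // -size_poly_eq0 => a0.
elim/poly_ind: b b0 => [|b e _]; rewrite ?eqxx // -size_poly_eq0 => b0.
have szS f x : size (f * 'X + x%:P) != 0%N ->
    size (f * 'X + x%:P) = (size f).+1.
  by rewrite size_MXaddC; case: ifP.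
have glue f x : divides p x -> divides p%:P f -> divides p%:P (f * 'X + x%:P).
  move=> [y ->] [g ->]; exists (g * 'X + y%:P).
  by rewrite mulrDl polyCM mulrAC.
rewrite ltnS => le d.
have: divides p (c * e).
  have [+ _] := dividesC_coef p ((a * 'X + c%:P) * (b * 'X + e%:P)).
  by move=> /(_ d 0%N); rewrite coef0M !coefD !coefMX !coefC !eqxx /= !add0r.
case/pP => h.
  have [|ha|] := IH a (b * 'X + e%:P) _ (step _ _ _ h d); last by right.
    by apply: leq_trans le; rewrite [size (a * _ + _)]szS.
  by left; exact: glue.
rewrite mulrC in d.
have [|ha|] := IH b (a * 'X + c%:P) _ (step _ _ _ h d); last by left.
  by apply: leq_trans le; rewrite addnC [size (b * _ + _)]szS // addnS.
by right; exact: glue.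
Qed.

Definition primitive f : Prop := forall c g, f = c%:P * g -> c \is a GRing.unit.

Hypothesis factR : factorial_ring R.

(** Among all ways of extracting a constant, take one that leaves a leading coefficient with the
    fewest prime factors. A further constant factor divides this coefficient, and by minimality it
    takes none of its primes, so it is a unit. *)
Lemma primitive_part f : f != 0 ->
  exists c g, [/\ c != 0, f = c%:P * g & primitive g].
Proof.
move=> f0; pose P n := exists c g s,
  [/\ f = c%:P * g, prime_factors (lead_coef g) s & size s = n].
have [|n [c [g [s [fE hs sn]]]] least] := @ex_least P.
  have [|s hs] := factR (a := lead_coef f); first by rewrite lead_coef_eq0.
  by exists (size s), 1, f, s; rewrite mul1r.
exists c, g; split=> [||e h gE].
- by apply: contraNneq f0 => c0; rewrite fE c0 mul0r.
- exact: fE.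
move: hs; rewrite gE lead_coefM lead_coefC.
case/prime_factors_split=> m [sm he hh].
have szm : (size (mask m s) + size (mask (map negb m) s) = n)%N.
  by rewrite !size_mask ?size_map // count_map count_predC sm.
apply: prime_factors_nil; move: he; case: (mask m s) szm => // p s' szm _.
have := least (size (mask (map negb m) s)); case/(_ _)/Wrap.
  exists (c * e), h, (mask (map negb m) s); split=> //.
  by rewrite fE gE polyCM mulrA.
by rewrite -szm /= addSn ltnNge leq_addl.
Qed.

(** The primes of c are cancelled one at a time: by Gauss's lemma each divides g or t, and
    primitivity excludes t. *)
Lemma primitive_dvd t c f g : primitive t -> c != 0 ->
  c%:P * f = g * t -> divides t f.
Proof.
move=> tP c0; have [s [ps [u uu ->]]] := factR c0.
elim: s ps f g => [|p s IH] ps f g.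
  rewrite big_nil mulr1 => E; exists (u^-1%:P * g).
  by rewrite -mulrA -E mulrA -polyCM mulVr // mul1r.
have pp : prime_elt p by apply: ps; rewrite mem_head.
have [p0 up _] := pp; have [_ _ pP] := prime_polyC pp.
rewrite big_cons mulrCA polyCM -mulrA => E.
have /pP[[q qE]|[q qE]] : divides p%:P (g * t) by rewrite -E mulrC; eexists.
  apply: (IH _ _ q) => [r rs|]; first by apply: ps; rewrite inE rs orbT.
  apply: (mulfI (x := p%:P)); first by rewrite polyC_eq0.
  by rewrite E qE mulrAC mulrC.
by move: up; rewrite (tP p q) // mulrC.
Qed.

Import Pdiv.Idomain.

(* A factor of least degree has a constant or full gcd with any polynomial, and
   primitivity turns divisibility over the fraction field into divisibility. *)
Lemma least_degree_prime t f : primitive t -> (1 < size t)%N -> f != 0 ->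
  t %| f ->
  (forall r : {poly R}, (1 < size r)%N -> r %| f -> (size t <= size r)%N) ->
  prime_elt t.
Proof.
move=> tP st f0 tf least.
have t0 : t != 0 by rewrite -size_poly_gt0 ltnW.
have strict h : t %| h -> divides t h.
  by case/dvdpP=> -[c q] /= c0; rewrite -mul_polyC; exact: primitive_dvd.
split=> // [|a b [q qE]].
  by rewrite poly_unitE; case: eqP st => // ->.
have tab : t %| a * b by apply/dvdpP; exists (1, q); rewrite ?oner_eq0 ?scale1r.
have d0 : gcdp t a != 0 by rewrite gcdp_eq0 (negPf t0).
have [sd|] := ltnP 1 (size (gcdp t a)).
  left; apply: strict; apply: dvdp_trans (dvdp_gcdr t a).
  have: gcdp t a %= t; last by rewrite /eqp => /andP[].
  rewrite -dvdp_size_eqp ?dvdp_gcdl // eqn_leq dvdp_leq ?dvdp_gcdl //=.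
  by apply: least => //; apply: dvdp_trans tf; exact: dvdp_gcdl.
rewrite leq_eqVlt ltnS leqn0 size_poly_eq0 (negPf d0) orbF => cop.
by right; apply: strict; rewrite -(Gauss_dvdpr b (q := a)).
Qed.

(** From a nonconstant primitive polynomial one splits off the primitive part of a nonconstant
    divisor of least degree, which is prime; the quotient is again primitive and shorter. The
    content is factored in R. *)
Lemma factorial_poly : factorial_ring {poly R}.
Proof.
have prim g : primitive g -> g != 0 -> exists s, prime_factors g s.
  have [n] := ubnP (size g); elim: n g => // n IH g; rewrite ltnS => le gP g0.
  have [sg|sg] := leqP (size g) 1.
    exists [::]; split=> //; exists g; last by rewrite big_nil mulr1.
    rewrite (size1_polyC sg) poly_unitE coefC size_polyC eqxx.
    have ug : g`_0 \is a GRing.unit.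
      by apply: (gP _ 1); rewrite mulr1; exact: size1_polyC.
    by rewrite ug andbT; apply/eqP; case: eqP ug => // ->; rewrite unitr0.
  have [|m [r [sr rg rm]] least] := @ex_least
      (fun m => exists r : {poly R}, [/\ (1 < size r)%N, r %| g & size r = m]).
    by exists (size g), g; rewrite dvdpp.
  have r0 : r != 0 by rewrite -size_poly_gt0 ltnW.
  have [c [t [c0 rE tP]]] := primitive_part r0.
  have rt : size r = size t by rewrite rE mul_polyC size_scale.
  have st : (1 < size t)%N by rewrite -rt.
  have tg : t %| g.
    apply: dvdp_trans rg; apply/dvdpP.
    by exists (1, c%:P); rewrite ?oner_eq0 ?scale1r.
  have tprime : prime_elt t.
    apply: (least_degree_prime tP _ g0 tg); rewrite -rt // rm => h sh hg.
    by apply: least; exists h.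
  have [q gE] : divides t g.
    by case/dvdpP: tg => -[e q] /= e0; rewrite -mul_polyC; exact: primitive_dvd.
  have t0 : t != 0 by case: tprime.
  have q0 : q != 0 by apply: contraNneq g0 => q0; rewrite gE q0 mul0r.
  have [|e h hE||s hs] := IH q.
  - apply: leq_trans le; rewrite gE size_mul //.
    by rewrite -subn1 -addnBA ?(ltnW st) // -addn1 leq_add2l subn_gt0.
  - by apply: (gP _ (h * t)); rewrite mulrA -hE.
  - by [].
  exists (s ++ [:: t]); rewrite gE; apply: prime_factors_cat hs _.
  split=> [p|]; first by rewrite inE => /eqP->.
  by exists 1; rewrite ?unitr1 // big_seq1 mul1r.
move=> f f0; have [c [g [c0 fE gP]]] := primitive_part f0.
have [|s hs] := prim g gP.
  by apply: contraNneq f0 => g0; rewrite fE g0 mulr0.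
rewrite {f f0}fE.
have [r [pr [u uu ->]]] := factR c0.
exists (map polyC r ++ s); apply: prime_factors_cat hs.
split=> [_ /mapP[p /pr pp ->]|]; first exact: prime_polyC.
exists u%:P.
  rewrite poly_unitE size_polyC coefC eqxx uu andbT; apply/eqP.
  by case: eqP uu => // ->; rewrite unitr0.
by rewrite big_map polyCM rmorph_prod.
Qed.

End PolyFactorial.

Lemma factorial_iso (A B : idomainType) (phi : {rmorphism A -> B})
    (psi : {rmorphism B -> A}) :
  cancel phi psi -> cancel psi phi -> factorial_ring B -> factorial_ring A.
Proof.
move=> phiK psiK fB a a0.
have unit_psi u : u \is a GRing.unit -> psi u \is a GRing.unit.
  by move=> uu; exact: rmorph_unit.
have [|s [ps [u uu E]]] := fB (phi a).
  by rewrite -(rmorph0 phi) (inj_eq (can_inj phiK)).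
exists (map psi s); split=> [_ /mapP[p /ps [p0 pu pP] ->]|]; last first.
  exists (psi u); first exact: unit_psi.
  by rewrite big_map -rmorph_prod -rmorphM -E phiK.
split=> [||x y [q qE]].
- by rewrite -(rmorph0 psi) (inj_eq (can_inj psiK)).
- by apply: contra pu => /(rmorph_unit phi); rewrite psiK.
have /pP : divides p (phi x * phi y).
  by exists (phi q); rewrite -rmorphM qE rmorphM psiK.
case=> -[r rE]; [left|right]; exists (psi r).
  by rewrite -rmorphM -rE phiK.
by rewrite -rmorphM -rE phiK.
Qed.

Section MpolyFactorial.
Variables (n : nat) (K : fieldType).

(** The inverse of [muni], which reads a polynomial as one in its last variable; the isomorphism
    drives the induction on the number of variables. *)
Let unmuni (q : {poly {mpoly K[n]}}) : {mpoly K[n.+1]} :=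
  (map_poly (@mwiden n K) q).['X_ord_max].

Fact unmuni_additive : additive unmuni.
Proof. by move=> p q; rewrite /unmuni rmorphB hornerD hornerN. Qed.

Fact unmuni_multiplicative : multiplicative unmuni.
Proof.
by split=> [p q|]; rewrite /unmuni ?rmorph1 ?hornerC // rmorphM hornerM.
Qed.

HB.instance Definition _ := GRing.isAdditive.Build _ _ unmuni unmuni_additive.
HB.instance Definition _ :=
  GRing.isMultiplicative.Build _ _ unmuni unmuni_multiplicative.

Let muniX m : muni 'X_[m] =
  'X_[[multinom m (widen_ord (leqnSn n) i) | i < n]] *: 'X^(m ord_max)
    :> {poly {mpoly K[n]}}.
Proof. by rewrite muniE msuppX big_seq1 mcoeffX eqxx scale1r. Qed.

Lemma muniK : cancel (@muni n K) unmuni.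
Proof.
move=> p; rewrite [p in RHS]mpolyE [p in LHS]mpolyE.
rewrite (raddf_sum (@muni n K)) (raddf_sum unmuni).
apply: eq_bigr => m _.
rewrite -mul_mpolyC /= muniM (rmorphM unmuni); congr (_ * _).
  by rewrite muniC /= /unmuni map_polyC hornerC /= mwidenC.
rewrite muniX /= /unmuni map_polyZ map_polyXn hornerZ hornerXn /= mwidenX.
rewrite mpolyXn -mpolyXD; congr 'X_[_]; apply/mnmP => i.
rewrite mnmDE mulmnE mnm1E.
have [j ->|->] := unliftP ord_max i.
  rewrite (_ : lift ord_max j = widen_ord (leqnSn n) j); last first.
    by apply: val_inj; rewrite /= /bump leqNgt ltn_ord.
  rewrite mnmwiden_widen mnmE (_ : _ == _ = false) ?addn0 //.
  by apply/negbTE; rewrite -val_eqE /= neq_ltn ltn_ord orbT.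
by rewrite mnmwiden_ordmax eqxx mul1n.
Qed.

Lemma unmuniK : cancel unmuni (@muni n K).
Proof.
have wid (c : {mpoly K[n]}) : muni (mwiden c) = c%:P.
  rewrite [c]mpolyE (big_morph _ (@mwidenD n K) (@mwiden0 n K)).
  rewrite (big_morph _ (@muniD n K) (@muni0 n K)) raddf_sum.
  apply: eq_bigr => m _; rewrite -!mul_mpolyC /= mwidenM muniM.
  rewrite (rmorphM polyC) /=.
  rewrite mwidenC muniC mwidenX muniX.
  congr (_ * _); rewrite mnmwiden_ordmax expr0 alg_polyC; congr (_%:P).
  by congr 'X_[_]; apply/mnmP => i; rewrite mnmE mnmwiden_widen.
move=> q; elim/poly_ind: q => [|q c IH]; first by rewrite !rmorph0.
rewrite !(rmorphD, rmorphM) /= IH; congr (_ * _ + _).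
  rewrite /unmuni map_polyX hornerX muniX mnm1E eqxx.
  rewrite (_ : [multinom _ | i < n] = 0%MM) ?mpolyX0 ?scale1r //.
  apply/mnmP => i; rewrite mnmE mnm0E mnm1E -val_eqE /=.
  by apply/eqP; rewrite eqb0 neq_ltn ltn_ord orbT.
by rewrite /unmuni map_polyC hornerC /= wid.
Qed.

End MpolyFactorial.

Lemma factorial_mpoly n (K : fieldType) : factorial_ring {mpoly K[n]}.
Proof.
elim: n => [|n IH].
  move=> p p0; exists [::]; split=> //; exists p; last by rewrite big_nil mulr1.
  move: p0; rewrite [p]nvar0_mpolyC mpolyC_eq0 => c0.
  apply/unitrP; exists ((p@_0)^-1)%:MP.
  by rewrite -!mpolyCM mulVf ?mulfV.
by apply: factorial_iso (@muniK n K) (@unmuniK n K) _; exact: factorial_poly.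
Qed.

(** * Families without common factor *)

Section CoprimeFamily.
Variables (R : idomainType) (I : Type).
Hypothesis factR : factorial_ring R.
Implicit Types (F G : I -> R).

Definition coprime_family G : Prop :=
  forall h, (forall i, divides h (G i)) -> h \is a GRing.unit.

(** Cancel the primes of c one by one: a prime of c that does not divide a would divide every
    G_i. *)
Lemma coprime_family_divides F G a c : c != 0 -> coprime_family G ->
  (forall i, a * G i = F i * c) -> divides c a.
Proof.
move=> c0 cG; have [s [ps [u uu ->]]] := factR c0.
elim: s ps a F => [|p s IH] ps a F E.
  by exists (a / u); rewrite big_nil mulr1 divrK.
have [p0 pu pP] := ps p (mem_head _ _).
have ps' q : q \in s -> prime_elt q.
  by move=> qs; apply: ps; rewrite inE qs orbT.
case: (classic (divides p a)) => [[b bE]|npa].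
  have [i|q qE] := IH ps' b F.
    apply: (mulIf p0); rewrite mulrAC -bE E big_cons -!mulrA.
    by congr (_ * (_ * _)); rewrite mulrC.
  exists q; rewrite bE qE big_cons -!mulrA.
  by congr (_ * (_ * _)); rewrite mulrC.
case/negP: pu; apply: cG => i.
have /pP[] // : divides p (a * G i).
exists (F i * (u * \prod_(q <- s) q)).
by rewrite E big_cons -!mulrA; congr (_ * (_ * _)); rewrite mulrC.
Qed.

Lemma coprime_family_exp G b : coprime_family G ->
  coprime_family (fun i => G i ^+ b).
Proof.
move=> cG h hG; have [h0|h0] := eqVneq h 0.
  apply: cG => i; exists 0; have [q] := hG i.
  by rewrite h0 !mulr0 => /eqP; rewrite expf_eq0 => /andP[_ /eqP].
have [[|p s] hs] := factR h0; first exact: prime_factors_nil hs.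
have [ps [u uu hE]] := hs; have [p0 pu pP] := ps p (mem_head _ _).
case/negP: pu; apply: cG => i.
have: divides p (G i ^+ b).
  apply: divides_trans (hG i); exists (u * \prod_(q <- s) q).
  by rewrite hE big_cons mulrCA mulrC.
elim: b {hG} => [|b IH]; last by rewrite exprS => /pP[|/IH].
by case=> q E; exists (G i * q); rewrite -mulrA -E mulr1.
Qed.

End CoprimeFamily.

(** * Homogeneous coordinates *)

Section Homogeneous.
Variables (K : fieldType) (n : nat).
Implicit Types (p q h : {mpoly K[n]}).

Lemma msize_homog e p : p != 0 -> p \is e.-homog -> msize p = e.+1.
Proof.
move=> p0 hp; rewrite -mlead_deg //.
by rewrite ((elimT (dhomogP _ _ _) hp) _ (mlead_supp p0)).
Qed.

(** The component of h p in degree i + e is the component of h in degree i times p, so only the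
    component of h in degree m - e can survive. *)
Lemma homog_cofactor m e h p : p != 0 -> p \is e.-homog ->
  h * p \is m.-homog -> h \is (m - e).-homog.
Proof.
move=> p0 hp hhp.
have part i : pihomog mdeg (i + e) (h * p) = pihomog mdeg i h * p.
  rewrite {1}(pihomog_partitionE (leqnn (msize h))) mulr_suml raddf_sum /=.
  have hom j : pihomog mdeg j h * p \is (j + e).-homog.
    by rewrite dhomogM // pihomogP.
  have [lt|le] := ltnP i (msize h).
    rewrite (bigD1 (Ordinal lt)) //= pihomog_dE // big1 ?addr0 // => j ne.
    by apply: pihomog_ne0 (hom _); rewrite eqn_add2r.
  rewrite big1 => [|j _]; last first.
    apply: pihomog_ne0 (hom _); rewrite eqn_add2r neq_ltn.
    by rewrite (leq_trans (ltn_ord j)).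
  rewrite [pihomog _ i h]big1_seq ?mul0r // => l /andP[/eqP il /msize_mdeg_lt].
  by rewrite il ltnNge le.
rewrite (pihomog_partitionE (leqnn (msize h))) rpred_sum // => i _.
have [ie|ne] := eqVneq (i + e)%N m.
  by rewrite -ie addnK pihomogP.
rewrite (_ : pihomog _ _ _ = 0) ?dhomog0 //; apply: (mulIf p0).
by rewrite -part mul0r; apply: pihomog_ne0 hhp; rewrite eq_sym.
Qed.

Lemma mpolyX_neq0 (i : 'I_n) : 'X_i != 0 :> {mpoly K[n]}.
Proof.
apply/eqP => /(congr1 (mcoeff U_(i))).
by rewrite mcoeffX eqxx mcoeff0 => /eqP; rewrite oner_eq0.
Qed.

Lemma msizeM_homog e h p : h != 0 -> p != 0 -> p \is e.-homog ->
  msize (h * p) = (msize h + e)%N.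
Proof. by move=> h0 p0 hp; rewrite msizeM // (msize_homog p0 hp) addnS. Qed.

Lemma mpoly_unitE p : (p \is a GRing.unit) = (msize p == 1%N).
Proof.
apply/idP/eqP => [pu|/eqP sp].
  have p0 : p != 0 by apply: contraTneq pu => ->; rewrite unitr0.
  have q0 : p^-1 != 0 by rewrite invr_eq0.
  have := congr1 (fun q : {mpoly K[n]} => msize q) (mulrV pu).
  rewrite msizeM // msize1.
  have := msize_poly_eq0 p; have := msize_poly_eq0 p^-1.
  rewrite (negPf p0) (negPf q0); case: (msize p) => // -[|a] //.
  by case: (msize p^-1) => // b _ _; rewrite addnS.
have pE : p = (p@_0)%:MP by apply: msize1_polyC; rewrite (eqP sp).
have c0 : p@_0 != 0.
  by apply: contraTneq sp => c0; rewrite pE c0 mpolyC0 mmeasure0.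
apply/unitrP; exists ((p@_0)^-1)%:MP.
by rewrite pE mcoeffC eqxx mulr1 -!mpolyCM mulVf ?mulfV.
Qed.

Lemma size_prime_factors p s : prime_factors p s -> (size s < msize p)%N.
Proof.
case=> ps [u uu ->].
have u0 : u != 0 by apply: contraTneq uu => ->; rewrite unitr0.
elim: s ps => [_|q s IH ps]; first by rewrite big_nil mulr1 lt0n msize_poly_eq0.
have [q0 qu _] := ps q (mem_head _ _).
have /IH lt : forall r, r \in s -> prime_elt r.
  by move=> r rs; apply: ps; rewrite inE rs orbT.
set b := u * _ in lt; have b0 : b != 0.
  by rewrite -msize_poly_eq0 -lt0n (leq_ltn_trans _ lt).
have sq : (1 < msize q)%N.
  rewrite mpoly_unitE in qu; rewrite ltn_neqAle eq_sym qu lt0n.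
  by rewrite msize_poly_eq0.
rewrite big_cons mulrCA msizeM // -/b -(prednK (ltnW sq)) addSn /=.
by rewrite -addn1 addnC leq_add // -ltnS prednK // ltnW.
Qed.

End Homogeneous.

Section Coordinates.
Variables (K : fieldType) (k : nat).
Implicit Types (F G H : coords K k) (p q h : {mpoly K[k.+1]}).

Lemma same_map_sym F G : same_map F G -> same_map G F.
Proof. by move=> s i j; rewrite mulrC s mulrC. Qed.

Lemma same_map_trans F G H : (exists l, tnth G l != 0) ->
  same_map F G -> same_map G H -> same_map F H.
Proof.
move=> [l Gl] FG GH i j; apply: (mulIf Gl).
by rewrite mulrAC (FG i l) -mulrA (GH i j) mulrA -(FG j l) mulrAC.
Qed.

Lemma coprime_family_ncf G : no_common_factor G -> coprime_family (tnth G).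
Proof. by move=> cG h; exact: cG. Qed.

(** Unique factorization enters here: G_i0 divides F_i0 G_i for every i, hence divides F_i0, and the
    quotient is the common scale. *)
Lemma same_map_scale F G : (exists i, tnth G i != 0) -> no_common_factor G ->
  same_map F G -> exists h, forall i, tnth F i = h * tnth G i.
Proof.
move=> [i0 G0] /coprime_family_ncf cG sFG.
have [h hE] : divides (tnth G i0) (tnth F i0).
  by apply: (coprime_family_divides (@factorial_mpoly _ _) G0 cG) => i.
exists h => i; apply: (mulIf G0).
by rewrite sFG hE mulrAC.
Qed.

Lemma scale_same_map F G h :
  (forall i, tnth F i = h * tnth G i) -> same_map F G.
Proof. by move=> E i j; rewrite !E mulrAC. Qed.

Lemma degree_le F G e : rational_coords F -> homog_coords e G ->
  same_map F G -> (degree F <= e)%N.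
Proof.
move=> rF [[i Gi] hG] FG; have := has_degree_degree rF.
set d := degree F => -[H [[H0 hH] cH FH]].
have F0 : exists l, tnth F l != 0 by case: rF => e' [].
have [h hE] := same_map_scale H0 cH (same_map_trans F0 (same_map_sym FG) FH).
move: (Gi); rewrite hE mulf_eq0 negb_or => /andP[h0 Hi].
have := msizeM_homog h0 Hi (hH i); rewrite -hE (msize_homog Gi (hG i)).
have := msize_poly_eq0 h; rewrite (negPf h0); case: (msize h) => // a _ [->].
exact: leq_addl.
Qed.

Lemma reduced_coords F : rational_coords F ->
  exists G h, [/\ homog_coords (degree F) G, no_common_factor G, h != 0
    & forall i, tnth F i = h * tnth G i].
Proof.
move=> rF; have [G [hG cG FG]] := has_degree_degree rF.
have [h hE] := same_map_scale (proj1 hG) cG FG.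
exists G, h; split=> //; apply/eqP => h0.
by have [e [[i]]] := rF; rewrite hE h0 mul0r eqxx.
Qed.

(** A nonunit dividing both X_0 and X_k would be proportional to each, although these are distinct
    variables. For k = 0 the single coordinate X_0 is itself a common factor. *)
Lemma id_coords_ncf : (0 < k)%N -> no_common_factor (id_coords K k).
Proof.
move=> k0 h hX; rewrite mpoly_unitE.
have X0 := @mpolyX_neq0 K k.+1.
have mul i : exists q, 'X_i = q * h by have := hX i; rewrite tnth_mktuple.
have [q0 E0] := mul ord0; have [q1 E1] := mul ord_max.
have sz q (i : 'I_k.+1) : 'X_i = q * h -> msize h != 1%N ->
    exists c, 'X_i = c *: h.
  move=> E nh; have := X0 i; rewrite E mulf_eq0 negb_or => /andP[qn hn].
  have := congr1 (fun p : {mpoly K[k.+1]} => msize p) E.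
  have := msize_poly_eq0 h; have := msize_poly_eq0 q.
  rewrite (negPf qn) (negPf hn) msizeM // msizeX mdeg1.
  case sq: (msize q) => [|[|a]] //; case: (msize h) nh => [|[|b]] // _ _ _.
    move=> _; exists q@_0; rewrite -mul_mpolyC -msize1_polyC ?sq //.
  by rewrite !addnS addSn.
apply/negPn/negP => nh.
have [c hc] := sz _ _ E0 nh; have [e he] := sz _ _ E1 nh.
have := X0 ord0; rewrite hc => ch.
have e0 : e != 0 by apply: contraNneq (X0 ord_max) => e0; rewrite he e0 scale0r.
have: e *: 'X_ord0 = c *: 'X_ord_max :> {mpoly K[k.+1]}.
  by rewrite hc he !scalerA mulrC.
move/(congr1 (mcoeff U_(ord0))); rewrite !mcoeffZ !mcoeffX eqxx mulr1.
rewrite (_ : (U_(ord_max) == U_(ord0))%MM = false) ?mulr0; first exact/eqP.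
apply/eqP => /mnmP/(_ ord0); rewrite !mnm1E eqxx -val_eqE /=.
by case: (k) k0.
Qed.

End Coordinates.

(** Compare the numerators factor by factor: a(d+1) + i is at most (d+1)(a + i). *)
Lemma bin_scale k d a :
  ('C(a * d.+1 + k, k) <= d.+1 ^ k * 'C(a + k, k))%N.
Proof.
elim: k => [|k IH]; first by rewrite !bin0.
rewrite -(leq_pmul2l (ltn0Sn k)) -mul_bin_diag mulnCA -mul_bin_diag !addnS /=.
rewrite expnS mulnACA; apply: leq_mul IH.
by rewrite -!addnS mulnDr [(a * _)%N]mulnC leq_add2l leq_pmull.
Qed.

(** * Degree of the inverse *)

Section InversePair.
Variables (K : fieldType) (k : nat).
Implicit Types (F G : coords K k) (p q h : {mpoly K[k.+1]}).

Definition inverse_pair F G d d' H H' : Prop :=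
  [/\ homog_coords d F /\ homog_coords d' G,
      no_common_factor F /\ no_common_factor G, H != 0 /\ H' != 0,
      forall i, tnth G i \mPo F = H * 'X_i
    & forall i, tnth F i \mPo G = H' * 'X_i].

Lemma inverse_pair_sym F G d d' H H' :
  inverse_pair F G d d' H H' -> inverse_pair G F d' d H' H.
Proof. by case=> -[? ?] [? ?] [? ?] ? ?; split. Qed.

Lemma comp_mpoly_homogM (r : nat) p h F G : p \is r.-homog ->
  (forall i, tnth F i = h * tnth G i) -> p \mPo F = h ^+ r * (p \mPo G).
Proof.
move=> hp E; rewrite -comp_mpoly_scale //; congr (_ \mPo _).
by apply: eq_from_tnth => i; rewrite tnth_mktuple.
Qed.

Lemma inverse_pair_comp F G d d' H H' (r : nat) p :
  inverse_pair F G d d' H H' -> p \is r.-homog ->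
  (p \mPo F) \mPo G = H' ^+ r * p.
Proof.
case=> _ _ _ _ FG hp; rewrite comp_mpolyA -[p in RHS]comp_mpoly_id.
by apply: comp_mpoly_homogM hp _ => i; rewrite !tnth_mktuple.
Qed.

Lemma inverse_pair_neq0 F G d d' H H' (r : nat) p :
  inverse_pair F G d d' H H' -> p \is r.-homog -> p != 0 -> p \mPo F != 0.
Proof.
move=> FG hp p0; have [_ _ [_ H'0] _ _] := FG.
apply: contraTneq (mulf_neq0 (expf_neq0 r H'0) p0) => pF.
by rewrite -(inverse_pair_comp FG hp) pF comp_mpoly0 eqxx.
Qed.

Section Denominator.
Variables (F G : coords K k) (d d' : nat) (H H' : {mpoly K[k.+1]}).
Hypothesis FG : inverse_pair F G d d' H H'.
Variables (a b : nat) (i : 'I_k.+1).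

Let term_homog (R : {ffun 'I_b.+1 -> dhomog k.+1 K a}) :
  \sum_(j < b.+1) (val (R j) \mPo F) * ('X_i ^+ j * 'X_ord0 ^+ (b - j))
    \is (a * d + b).-homog.
Proof.
have [[_ hF] _] : homog_coords d F /\ homog_coords d' G by case: FG.
apply: rpred_sum => j _; apply: dhomogM.
  by apply: comp_mpoly_homog => //; exact: valP.
rewrite -[X in X.-homog](subnKC (leq_ord j)).
apply: dhomogM; rewrite -[X in X.-homog]mul1n; apply: dhomogMn.
  by rewrite dhomogX; apply/eqP/mdeg1.
by rewrite dhomogX; apply/eqP/mdeg1.
Qed.

(** A kernel element is an equation of degree at most b for X_i / X_0 whose coefficients are forms
    of degree a in the coordinates of F. Linearity in R allows it to be found by a dimension
    count. *)
Let eliminant R : dhomog k.+1 K (a * d + b) := DHomog (term_homog R).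

Fact eliminant_linear : linear eliminant.
Proof.
move=> c R S; apply: val_inj; rewrite /= scaler_sumr -big_split.
apply: eq_bigr => j _; rewrite !ffunE /= linearP /=.
by rewrite mulrDl scalerAl.
Qed.
HB.instance Definition _ :=
  GRing.isLinear.Build _ _ _ _ eliminant eliminant_linear.

Lemma eliminant_ker : ('C(a * d + b + k, a * d + b) < b.+1 * 'C(a + k, a))%N ->
  exists2 R : {ffun 'I_b.+1 -> dhomog k.+1 K a}, R != 0 &
    \sum_(j < b.+1) (val (R j) \mPo F) * ('X_i ^+ j * 'X_ord0 ^+ (b - j)) = 0.
Proof.
move=> lt; pose L := linfun eliminant.
have: (lker L != 0)%VS.
  rewrite -[lker L]capfv -dimv_eq0 -lt0n -(ltn_add2r (\dim (limg L))).
  rewrite limg_ker_dim add0n.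
  apply: leq_ltn_trans (dimvS (subvf (limg L))) _.
  by rewrite !dimvf /dim /= card_ord.
move=> ker0; exists (vpick (lker L)); first by rewrite vpick0.
have := memv_pick (lker L); rewrite memv_ker lfunE /= => /eqP/(congr1 val).
by [].
Qed.

(* [R] is the leading coefficient of an algebraic relation, found by counting
   dimensions, between X_i / X_0 and the coordinates of F; the denominator of
   G_i / G_0 must divide it. *)
Lemma denominator_bound :
  ('C(a * d + b + k, a * d + b) < b.+1 * 'C(a + k, a))%N ->
  exists R : {mpoly K[k.+1]},
    [/\ R != 0, R \is (a).-homog & divides (tnth G ord0) (R * tnth G i ^+ b)].
Proof.
case/eliminant_ker => R R0 E.
have [[_ [_ hG]] _ [H0 _] GF _] := FG.
have G0 : tnth G ord0 != 0.
  have : H * 'X_ord0 != 0 by rewrite mulf_neq0 // mpolyX_neq0.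
  by rewrite -GF; apply: contraNneq => ->; rewrite comp_mpoly0.
(* Pulled back by F, this sum is H^b times the relation [E], and pulling back by F kills no nonzero
   form. *)
have rel : \sum_(j < b.+1)
    val (R j) * (tnth G i ^+ j * tnth G ord0 ^+ (b - j)) = 0.
  apply/eqP; set S := \sum_(j < _) _.
  have hS : S \is (a + d' * b).-homog.
    apply: rpred_sum => j _; apply: dhomogM; first exact: valP.
    have -> : (d' * b = d' * j + d' * (b - j))%N.
      by rewrite -mulnDr subnKC // leq_ord.
    by apply: dhomogM; apply: dhomogMn.
  apply: contraTT (oner_neq0 {mpoly K[k.+1]}) => /(inverse_pair_neq0 FG hS).
  case/eqP; rewrite -[RHS](mulr0 (H ^+ b)) -E mulr_sumr rmorph_sum.
  apply: eq_bigr => j _; rewrite !rmorphM !rmorphXn /= !GF.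
  rewrite [RHS]mulrCA; congr (_ * _); rewrite !exprMn mulrACA -exprD subnKC //.
  exact: leq_ord.
have [j0 Rj0] : exists j, R j != 0.
  apply/existsP; apply: contraR R0 => /existsPn R0.
  apply/eqP/ffunP => j; rewrite ffunE; apply/eqP.
  by have := R0 j; rewrite negbK.
(* With m the top index, G_0^(b-m) cancels from the relation, and then every term but the m-th is
   divisible by G_0. *)
pose m := [arg max_(j > j0 | R j != 0) val j]; have [Rm top] : R m != 0 /\
    forall j, R j != 0 -> (j <= m)%N by rewrite /m; case: arg_maxnP.
exists (val (R m)); split=> //; first exact: valP.
have: \sum_(j < b.+1 | (j <= m)%N) val (R j) *
    (tnth G i ^+ j * tnth G ord0 ^+ (m - j)) = 0.
  apply: (mulfI (expf_neq0 (b - m) G0)).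
  rewrite mulr0 -[RHS]rel mulr_sumr big_mkcond.
  apply: eq_bigr => j _; case: ifPn => [le|nle].
    rewrite mulrCA; congr (_ * _); rewrite mulrCA -exprD; congr (_ * _ ^+ _).
    by rewrite addnBA // subnK // leq_ord.
  rewrite (_ : R j = 0) ?mul0r //.
  by apply/eqP; apply: contraR nle => /top.
rewrite (bigD1 m) //= subnn mulr1 => /eqP; rewrite addr_eq0 => /eqP mE.
have: divides (tnth G ord0) (val (R m) * tnth G i ^+ m).
  rewrite mE -sumrN; elim/big_rec: _ => [|j x /andP[le ne] [q ->]].
    by exists 0; rewrite mul0r.
  have lt : (0 < m - j)%N by rewrite subn_gt0 ltn_neqAle le andbT.
  exists (- (val (R j) * (tnth G i ^+ j * tnth G ord0 ^+ (m - j).-1)) + q).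
  by rewrite mulrDl mulNr -!mulrA -exprSr prednK.
case=> q qE; exists (q * tnth G i ^+ (b - m)).
by rewrite mulrAC -qE -mulrA -exprD subnKC // leq_ord.
Qed.
End Denominator.

(** The product P of the k denominators, of degree k a, is such that G_0 divides P G_i^b for every
    i, including i = 0 because b > 0. As the powers G_i^b have no common factor, G_0 divides P. *)
Lemma inverse_degree_le F G d d' H H' a b : inverse_pair F G d d' H H' ->
  (0 < b)%N -> ('C(a * d + b + k, a * d + b) < b.+1 * 'C(a + k, a))%N ->
  (d' <= k * a)%N.
Proof.
move=> FG b0 lt; have den i := denominator_bound FG i lt.
pose R i := proj1_sig (constructive_indefinite_description _ (den i)).
have RP i : [/\ R i != 0, R i \is (a).-homog
              & divides (tnth G ord0) (R i * tnth G i ^+ b)].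
  by rewrite /R; case: constructive_indefinite_description.
have [[_ [[l Gl] hG]] [_ cG] [H0 _] GF _] := FG.
have G0 : tnth G ord0 != 0.
  have : H * 'X_ord0 != 0 by rewrite mulf_neq0 // mpolyX_neq0.
  by rewrite -GF; apply: contraNneq => ->; rewrite comp_mpoly0.
pose P := \prod_(j < k) R (lift ord0 j).
have P0 : P != 0 by apply/prodf_neq0 => j _; case: (RP (lift ord0 j)).
have hP : P \is (k * a).-homog.
  rewrite /P -[k in (k * a)%N]card_ord -sum_nat_const.
  elim/big_rec2: _ => [|j p x _ IH]; first exact: dhomog1.
  by apply: dhomogM IH; case: (RP (lift ord0 j)).
have dP i : divides (tnth G ord0) (P * tnth G i ^+ b).
  have [j ->|->] := unliftP ord0 i.
    have [_ _ [q qE]] := RP (lift ord0 j).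
    exists (q * \prod_(m < k | m != j) R (lift ord0 m)).
    by rewrite /P (bigD1 j) //= mulrAC qE mulrAC.
  by exists (P * tnth G ord0 ^+ b.-1); rewrite -mulrA -exprSr prednK.
pose q i := proj1_sig (constructive_indefinite_description _ (dP i)).
have qE i : P * tnth G i ^+ b = q i * tnth G ord0.
  by rewrite /q; case: constructive_indefinite_description.
have [h hE] : divides (tnth G ord0) P.
  apply: (coprime_family_divides (@factorial_mpoly _ _) G0 _ qE).
  exact (coprime_family_exp (@factorial_mpoly _ _) (coprime_family_ncf cG)).
have h0 : h != 0 by apply: contraNneq P0 => h0; rewrite hE h0 mul0r.
have := msizeM_homog h0 G0 (hG ord0); rewrite -hE (msize_homog P0 hP).
have := msize_poly_eq0 h; rewrite (negPf h0); case: (msize h) => // x _ [->].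
exact: leq_addl.
Qed.

(** For a = b = (d+1)^k, [bin_scale] bounds the left binomial by a times the right one, just below
    the required b + 1 times. *)
Lemma inverse_degree_exp F G d d' H H' : inverse_pair F G d d' H H' ->
  (d' <= k * d.+1 ^ k)%N.
Proof.
set a := (d.+1 ^ k)%N => FG.
have a0 : (0 < a)%N by rewrite expn_gt0.
apply: inverse_degree_le FG a0 _.
rewrite -mulnSr -!(bin_sub (leq_addr k _)) !addKn.
apply: leq_ltn_trans (bin_scale _ _ _) _.
by rewrite -/a ltn_mul2r bin_gt0 leq_addl ltnSn.
Qed.

(** With a = 1 and b = d + 1 the count reads 2d + 2 < 2d + 4: birational maps of the line have
    degree at most one. *)
Lemma inverse_degree_line F G d d' H H' : k = 1%N ->
  inverse_pair F G d d' H H' -> (d' <= 1)%N.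
Proof.
move=> k1 FG; have := inverse_degree_le (a := 1) FG (ltn0Sn d).
rewrite k1 muln1 !mul1n -!(bin_sub (leq_addr 1 _)) !addKn !bin1; apply.
by lia.
Qed.

End InversePair.

(** * Sesquipowers and invariant spans *)

Section Sesquipowers.
Variable C : finType.
Implicit Types (u v w x y : seq C).

Fixpoint sesquipower s w : Prop :=
  if s is s'.+1 then
    exists w' v, sesquipower s' w' /\ w = w' ++ v ++ w'
  else size w = 1%N.

(* Among #|C| ^ len i + 1 consecutive blocks of length len i, two are equal. *)
Lemma sesquipower_factor (len : nat -> nat) s w : (0 < len 0%N)%N ->
  (forall i, (#|C| ^ len i).+1 * len i <= len i.+1)%N ->
  (len s <= size w)%N -> exists w' x y, sesquipower s w' /\ w = x ++ w' ++ y.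
Proof.
move=> len0 lenS; elim: s w => [|s IH] w lw.
  case: w lw => [|c w] lw; first by rewrite leqNgt len0 in lw.
  by exists [:: c], [::], w.
set l := len s in IH lenS; set q := (#|C| ^ l)%N.
have szb (i : 'I_q.+1) : size (take l (drop (i * l) w)) == l.
  rewrite size_take_min size_drop; apply/eqP/minn_idPl.
  rewrite leq_subRL; last first.
    by apply: leq_trans (leq_trans (lenS s) lw); rewrite leq_mul2r ltnW ?orbT.
  apply: leq_trans (leq_trans (lenS s) lw).
  by rewrite addnC -mulSn leq_mul2r orbC ltn_ord.
pose b i : l.-tuple C := Tuple (szb i).
have /injectivePn[i [j ne bij]] : ~~ injectiveb b.
  apply/negP => /injectiveP/leq_card.
  by rewrite card_ord card_tuple ltnn.
wlog lt : i j ne bij / (i < j)%N.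
  move=> W; case: (ltngtP i j) => [|lt|/val_inj E]; first exact: W.
    by apply: (W j i) => //; rewrite eq_sym.
  by rewrite E eqxx in ne.
have [w' [x [y [hw bE]]]] : exists w' x y,
    sesquipower s w' /\ b i = x ++ w' ++ y :> seq C.
  by apply: IH; rewrite size_tuple.
have cut m : drop (m * l) w = take l (drop (m * l) w) ++ drop (m.+1 * l) w.
  by rewrite mulSn -drop_drop cat_take_drop.
have bE' : take l (drop (i * l) w) = x ++ w' ++ y by [].
have bE2 : take l (drop (j * l) w) = x ++ w' ++ y.
  by rewrite -bE'; have := congr1 val bij => /= ->.
have [z zE] : exists z, drop (i.+1 * l) w = z ++ drop (j * l) w.
  exists (take (j * l - i.+1 * l) (drop (i.+1 * l) w)).
  rewrite -[in drop (j * l) w](subnK (leq_mul lt (leqnn l))) -drop_drop.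
  by rewrite cat_take_drop.
(* Both blocks equal x w' y, and z is what lies between them, so the two copies of w' are separated
   by y z x. *)
exists (w' ++ (y ++ z ++ x) ++ w'), (take (i * l) w ++ x),
  (y ++ drop (j.+1 * l) w).
split; first by exists w', (y ++ z ++ x).
by rewrite -{1}[w](cat_take_drop (i * l)) cut bE' zE cut bE2 -!catA.
Qed.

End Sesquipowers.

Section Chain.
Variables (K : fieldType) (k : nat) (F : coords K k) (P : nat -> coords K k).
Variables (C : finType) (c : nat -> C) (deg : C -> nat).
Variables (eta : C -> {mpoly K[k.+1]}) (n r : nat).
Implicit Types (u v w : seq C).

Let after m (p : {mpoly K[k.+1]}) := iter m (fun q => q \mPo F) p.

Hypothesis homogP : forall i, (i < n)%N -> homog_coords (deg (c i)) (P i).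
(** A letter fixes the cofactor only up to a scalar of K; recording the scalar too could make the
    alphabet infinite. *)
Hypothesis stepP : forall i, (i < n)%N -> exists a : K, forall l,
  tnth (P i) l \mPo F = a *: (eta (c i) * tnth (P i.+1) l).
Hypothesis dimP : forall x, ('C(deg x + k, deg x) <= r)%N.

Lemma afterSr m p : after m.+1 p = after m (p \mPo F).
Proof. exact: iterSr. Qed.

Lemma afterZM m a p q : after m (a *: (p * q)) = a *: (after m p * after m q).
Proof.
elim: m => [//|m IH].
by rewrite -[LHS]/(after m _ \mPo F) IH comp_mpolyZ rmorphM.
Qed.

(* [w] is the factor of the word c 0, ..., c n.-1 starting at position [i]. *)
Let occurs w i :=
  (i + size w <= n)%N && (mkseq (fun t => c (i + t)) (size w) == w).

Let eta_word := fix eta_word w :=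
  if w is x :: w' then after (size w') (eta x) * eta_word w' else 1.

Lemma occurs_cat u w i :
  occurs (u ++ w) i = occurs u i && occurs w (i + size u).
Proof.
rewrite /occurs size_cat addnA [mkseq _ (_ + _)]/mkseq iotaD map_cat.
rewrite eqseq_cat; last by rewrite size_map size_iota.
rewrite add0n -[in iota (size u) _](addn0 (size u)) iotaDl -map_comp.
rewrite [map (_ \o _) _](_ : _ = mkseq (fun t => c (i + size u + t)) (size w)).
  by case: (leqP (i + size u + size w) n) => [le|];
     rewrite ?andbF // (leq_trans (leq_addr _ _) le).
by apply: eq_map => t; rewrite /= addnA.
Qed.

Lemma occurs_head x w i : occurs (x :: w) i -> c i = x.
Proof. by case/andP=> _ /eqP[]; rewrite addn0. Qed.

Lemma occurs_lt x w i : occurs (x :: w) i -> (i < n)%N.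
Proof. by case/andP=> + _; apply: leq_trans; rewrite addnS ltnS leq_addr. Qed.

(** Up to a scalar, the cofactor accumulated along w depends on the word alone and not on the
    position i. *)
Lemma after_word w i : occurs w i -> exists a : K, forall l,
  after (size w) (tnth (P i) l) = a *: (eta_word w * tnth (P (i + size w)) l).
Proof.
elim: w i => [|x w IH] i.
  by exists 1 => l; rewrite scale1r mul1r addn0.
rewrite -cat1s occurs_cat => /andP[/andP[lt /eqP[xE]] /IH[b bE]].
move: lt; rewrite addn1 => /stepP[a aE]; exists (a * b) => l.
rewrite [LHS]afterSr aE afterZM.
have E : (i + size [:: x] = i.+1)%N by rewrite addn1.
rewrite E in bE; rewrite addn0 in xE.
rewrite bE -scalerAr scalerA mulrA xE -addSnnS; congr (_ *: (_ * _)).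
Qed.

(** Below, e is the degree attached to the first letter of w. Every P_i at which w occurs then has
    degree e, and the default value of [indhomog] is never met. *)
Let generators e w : seq (dhomog k.+1 K e) :=
  [seq indhomog e (tnth (P i) l) | i <- [seq i <- iota 0 n | occurs w i],
                                   l <- enum 'I_k.+1].

Let occurrence_span e w : {vspace dhomog k.+1 K e} := <<generators e w>>%VS.

Lemma mem_occurrence_span e w i l :
  (i < n)%N -> occurs w i -> tnth (P i) l \is e.-homog ->
  exists2 p, p \in occurrence_span e w & val p = tnth (P i) l.
Proof.
move=> lt ow he; exists (indhomog e (tnth (P i) l)); last first.
  by rewrite /indhomog val_insubd he.
apply/memv_span/allpairs_f; last exact: mem_enum.
by rewrite mem_filter ow mem_iota.
Qed.

Lemma occurrence_span_sub e w w' : (forall i, occurs w i -> occurs w' i) ->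
  (occurrence_span e w <= occurrence_span e w')%VS.
Proof.
move=> sub; apply: sub_span => _ /allpairsP[[i l] [hi hl ->]].
apply: allpairs_f => //; move: hi; rewrite !mem_filter => /andP[/sub-> ].
by [].
Qed.

(** The scalar a may vary with the occurrence, being absorbed by the span; the factor h is common to
    all occurrences, so linear combinations are carried along. *)
Lemma occurrence_span_after e x w w' t h :
  deg x = e ->
  (forall i, occurs (x :: w) i -> (i + t < n)%N /\ occurs w' (i + t)) ->
  (forall i, occurs (x :: w) i -> deg (c (i + t)) = e) ->
  (forall i, occurs (x :: w) i -> exists a : K, forall l,
    after t (tnth (P i) l) = a *: (h * tnth (P (i + t)) l)) ->
  forall p, p \in occurrence_span e (x :: w) ->
  exists2 p', p' \in occurrence_span e w' & after t (val p) = h * val p'.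
Proof.
move=> dx occ dt hP p hp; set s := generators e (x :: w) in hp.
rewrite (@coord_span _ _ _ (in_tuple s) p hp).
have afterL a q q' : after t (a *: q + q') = a *: after t q + after t q'.
  elim: t {occ dt hP} => [//|m IH].
  by rewrite -[LHS]/(after m _ \mPo F) IH linearP.
elim/big_rec: _ => [|j q _ [q' hq' qE]].
  exists 0; rewrite ?mem0v //= mulr0.
  by have := afterL (-1) 0 0; rewrite scaler0 addr0 scaleN1r addNr.
have /allpairsP[[i l] [/= + _ sE]] : s`_j \in s by rewrite mem_nth // ltn_ord.
rewrite mem_filter mem_iota => /andP[ow /andP[_ lt]].
have ci := occurs_head ow.
have [lt' ow'] := occ _ ow; have [a aE] := hP _ ow.
have [|p' hp' p'E] := @mem_occurrence_span e w' (i + t) l lt' ow'.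
  by have [_] := homogP lt'; rewrite dt.
have sv : val s`_j = tnth (P i) l.
  by rewrite sE /indhomog val_insubd -dx -ci; have [_ ->] := homogP lt.
exists (coord (in_tuple s) j p * a *: p' + q').
  by rewrite rpredD // rpredZ.
rewrite afterL qE sv aE -p'E; set b := coord _ _ _.
have -> : val (b * a *: p' + q') = (b * a) *: val p' + val q' by [].
by rewrite mulrDr -scalerAr scalerA.
Qed.

(** Here s is unrestricted, although the hypotheses concern only the first n steps: this is the
    passage from finitely many iterates to all of them. *)
Let returns : Prop := exists i t, [/\ (i < n)%N, (0 < t)%N &
  forall s, exists h (Q : coords K k),
    (forall l, tnth Q l \is (deg (c i)).-homog) /\
    forall l, after (s * t) (tnth (P i) l) = h * tnth Q l].

Lemma invariant_span_returns x w t h i : occurs (x :: w) i -> (0 < t)%N ->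
  (forall p, p \in occurrence_span (deg x) (x :: w) ->
    exists2 p', p' \in occurrence_span (deg x) (x :: w)
                & after t (val p) = h * val p') ->
  returns.
Proof.
move=> ow t0 inv; have lt := occurs_lt ow.
have ci := occurs_head ow.
exists i, t; split=> // s.
suff: exists h' (Q : 'I_k.+1 -> dhomog k.+1 K (deg x)),
  forall l, Q l \in occurrence_span (deg x) (x :: w) /\
     after (s * t) (tnth (P i) l) = h' * val (Q l).
  case=> h' [Q QE]; exists h', [tuple val (Q l) | l < k.+1].
  split=> l; rewrite tnth_mktuple; last by case: (QE l).
  by rewrite ci; exact: valP.
elim: s => [|s [h' [Q QE]]].
  have ex l : exists p,
      p \in occurrence_span (deg x) (x :: w) /\ val p = tnth (P i) l.
    have [|p] := @mem_occurrence_span (deg x) (x :: w) i l lt ow.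
      by rewrite -ci; case: (homogP lt).
    by exists p.
  pose Q l := proj1_sig (constructive_indefinite_description _ (ex l)).
  exists 1, Q => l; rewrite /Q.
  by case: constructive_indefinite_description => /= p [? ->]; rewrite mul1r.
have ex l : exists p, p \in occurrence_span (deg x) (x :: w) /\
    after t (val (Q l)) = h * val p.
  by have [/inv[p ? ?] _] := QE l; exists p.
pose Q' l := proj1_sig (constructive_indefinite_description _ (ex l)).
exists (after t h' * h), Q' => l.
rewrite /Q'; case: constructive_indefinite_description => /= p [? pE].
split=> //.
rewrite mulSn {1}/after iterD -/(after (s * t) _) -/(after t _).
have [_ ->] := QE l; have := afterZM t 1 h' (val (Q l)); rewrite !scale1r => ->.
by rewrite pE mulrA.
Qed.

(** At each level the span either stays the same, which makes it invariant, or loses at least one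
    dimension; the count starts from the bound r. *)
Lemma sesquipower_chain s w i : sesquipower s w -> occurs w i ->
  returns \/
  exists x w0, w = x :: w0 /\ (\dim (occurrence_span (deg x) w) + s <= r)%N.
Proof.
elim: s w => [|s IH] w /=.
  case: w => // x [] // _ _; right; exists x, [::]; split=> //.
  rewrite addn0; apply: leq_trans (dimvS (subvf _)) _.
  by rewrite dimvf; exact: dimP.
case=> w' [v [hw' ->]] ow; have := ow; rewrite occurs_cat => /andP[ow' _].
case: (IH _ hw' ow') => [|[x [w0 [E le]]]]; first by left.
set e := deg x in le.
have sub : (occurrence_span e (w' ++ v ++ w') <= occurrence_span e w')%VS.
  by apply: occurrence_span_sub => m; rewrite occurs_cat => /andP[].
case: (leqP (\dim (occurrence_span e w'))
            (\dim (occurrence_span e (w' ++ v ++ w')))) => [ge|lt].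
  left; have eqX : occurrence_span e (w' ++ v ++ w') = occurrence_span e w'.
    by apply/eqP; rewrite eqEdim sub.
  move: ow'; rewrite E; set t := size (w' ++ v) => ow'.
  apply: (invariant_span_returns (h := eta_word (w' ++ v)) (t := t) ow').
    by rewrite /t E.
  (* Only the source is replaced by the span of w' v w': an occurrence of that word contains w'
     again after |w' v| letters, so its image lies in the span of w'. *)
  rewrite -/e -E -{1}eqX {1}E; apply: occurrence_span_after => // m.
  - rewrite -cat_cons -E catA occurs_cat -/t => /andP[_ om]; split=> //.
    by move: om; rewrite E; exact: occurs_lt.
  - rewrite -cat_cons -E catA occurs_cat -/t => /andP[_]; rewrite E.
    by move/occurs_head->.
  rewrite -cat_cons -E catA occurs_cat => /andP[/after_word[a aE] _].
  by exists a.
right; exists x, (w0 ++ v ++ w'); split; first by rewrite E.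
by apply: leq_trans le; rewrite addnS -addSn leq_add2r.
Qed.

(** Otherwise a sesquipower of order r would have a zero span, although it occurs at a position
    whose coordinates are not all zero. *)
Lemma recurrence_returns (len : nat -> nat) : (0 < len 0%N)%N ->
  (forall i, (#|C| ^ len i).+1 * len i <= len i.+1)%N -> (len r <= n)%N -> 
  (forall i, exists l, tnth (P i) l != 0) -> returns.
Proof.
move=> len0 lenS le nzP.
have [|w [u [v [hw E]]]] := @sesquipower_factor C len r (mkseq c n) len0 lenS.
  by rewrite size_mkseq.
have : occurs (mkseq c n) 0 by rewrite /occurs size_mkseq add0n leqnn /=.
rewrite E !occurs_cat => /and3P[_ ow _].
case: (sesquipower_chain hw ow) => // -[x [w0 [wE]]].
rewrite -[X in (_ <= X)%N]add0n leq_add2r leqn0 dimv_eq0 => /eqP X0.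
rewrite add0n in ow; have lt : (size u < n)%N.
  by move: ow; rewrite wE; exact: occurs_lt.
have [l nz] := nzP (size u).
have [|p] := @mem_occurrence_span (deg x) w (size u) l lt ow.
  move: ow; rewrite wE => /occurs_head <-.
  by case: (homogP lt).
by rewrite X0 memv0 => /eqP-> E0; rewrite -E0 eqxx in nz.
Qed.

End Chain.

(** * The cofactors of the iterates *)

Section Iterates.
Variables (K : fieldType) (k : nat).
Implicit Types (f F G P : coords K k) (h : {mpoly K[k.+1]}).


Lemma reduced_comp_id f g F G c c' (d : nat) : (0 < k)%N ->
  rational_coords (comp_coords f g) ->
  same_map (comp_coords f g) (id_coords K k) ->
  (forall i, tnth F i \is d.-homog) ->
  (forall i, tnth f i = c * tnth F i) -> (forall i, tnth g i = c' * tnth G i) ->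
  exists2 H, H != 0 & forall i, tnth F i \mPo G = H * 'X_i.
Proof.
move=> k0 [e [[l nz] _]] fg hF fE gE.
set s := (c \mPo g) * c' ^+ d.
have E i : tnth (comp_coords f g) i = s * tnth (comp_coords F G) i.
  by rewrite !tnth_mktuple fE rmorphM /= (comp_mpoly_homogM (hF i) gE) mulrA.
have [] := @same_map_scale K k (comp_coords F G) (id_coords K k).
- by exists ord0; rewrite tnth_mktuple mpolyX_neq0.
- exact: id_coords_ncf.
- apply: same_map_trans (same_map_sym (scale_same_map E)) fg.
  by exists l.
move=> H HE; exists H => [|i]; last by have := HE i; rewrite !tnth_mktuple.
by apply: contraNneq nz => H0; rewrite E HE H0 mul0r mulr0.
Qed.

Lemma birational_inverse_pair f : (0 < k)%N -> birational f ->
  exists F G d' H H' c,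
    inverse_pair F G (degree f) d' H H' /\ forall i, tnth f i = c * tnth F i.
Proof.
move=> k0 [rf [g [rg rfg rgf fg gf]]].
have [F [c [hF cF _ fE]]] := reduced_coords rf.
have [G [c' [hG cG _ gE]]] := reduced_coords rg.
have [H' H'0 FG] := reduced_comp_id k0 rfg fg (proj2 hF) fE gE.
have [H H0 GF] := reduced_comp_id k0 rgf gf (proj2 hG) gE fE.
by exists F, G, (degree g), H, H', c.
Qed.

(** F is composed on the right, an operation linear in the coordinates of P_j; the argument with
    spans rests on this. *)
Definition reduced_orbit f F (P : nat -> coords K k)
    (h : nat -> {mpoly K[k.+1]}) : Prop :=
  forall j,
  [/\ homog_coords (degree (iterate f j)) (P j), no_common_factor (P j),
      h j != 0, same_map (iterate f j) (P j)
    & forall i, tnth (P j) i \mPo F = h j * tnth (P j.+1) i].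

Lemma iterate_recurrence f F G d d' H H' c : birational f ->
  inverse_pair F G d d' H H' -> (forall i, tnth f i = c * tnth F i) ->
  exists (P : nat -> coords K k) (h : nat -> {mpoly K[k.+1]}),
    reduced_orbit f F P h.
Proof.
move=> bf FG fE.
pose P j := proj1_sig (constructive_indefinite_description _
  (reduced_coords (rational_iterate j bf))).
have PP j : exists s, [/\ homog_coords (degree (iterate f j)) (P j),
    no_common_factor (P j), s != 0
    & forall i, tnth (iterate f j) i = s * tnth (P j) i].
  by rewrite /P; case: constructive_indefinite_description.
have step j : exists h, h != 0 /\
    forall i, tnth (P j) i \mPo F = h * tnth (P j.+1) i.
  have [s [hP cP s0 sE]] := PP j; have [s' [hP' cP' s'0 sE']] := PP j.+1.
  have E i : tnth (iterate f j.+1) i =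
      ((s \mPo f) * c ^+ degree (iterate f j)) * tnth (comp_coords (P j) F) i.
    rewrite iterateSr !tnth_mktuple sE rmorphM /=.
    by rewrite (comp_mpoly_homogM (proj2 hP i) fE) mulrA.
  have [||h hE] := @same_map_scale K k (comp_coords (P j) F) (P j.+1) _ cP'.
  - exact: proj1 hP'.
  - apply: same_map_trans (same_map_sym (scale_same_map E)) _; last first.
      exact: scale_same_map sE'.
    by have [e []] := rational_iterate j.+1 bf.
  exists h; split=> [|i]; last by have := hE i; rewrite tnth_mktuple.
  have [[l nz] hl] := hP.
  apply: contraNneq (inverse_pair_neq0 FG (hl l) nz) => h0.
  by have := hE l; rewrite tnth_mktuple h0 mul0r => ->.
pose h j := proj1_sig (constructive_indefinite_description _ (step j)).
exists P, h => j; have [s [hP cP s0 sE]] := PP j.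
have [h0 hE] : h j != 0 /\
    forall i, tnth (P j) i \mPo F = h j * tnth (P j.+1) i.
  by rewrite /h; case: constructive_indefinite_description.
by split=> //; exact: scale_same_map sE.
Qed.

(* P' o G = g P as well, so (h o G) g = H'^e; composing with F turns h o G into
   h times a power of H, and H' into H^d. *)
Lemma cofactor_divides F G d d' H H' P P' e e' h : inverse_pair F G d d' H H' ->
  homog_coords e P -> no_common_factor P -> homog_coords e' P' -> h != 0 ->
  (forall i, tnth P i \mPo F = h * tnth P' i) -> divides h (H ^+ (d * e)).
Proof.
move=> FG [[l Pl] hP] cP [[l' P'l] hP'] h0 E.
have [[[m0 Fm0] hF] _] : homog_coords d F /\ homog_coords d' G by case: FG.
have GF := inverse_pair_sym FG.
have [r hr] : exists r, h \is r.-homog.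
  exists (e * d - e')%N; apply: homog_cofactor P'l (hP' l') _.
  by rewrite -E; exact: comp_mpoly_homog.
have hG0 : h \mPo G != 0 := inverse_pair_neq0 GF hr h0.
have E' i : (h \mPo G) * (tnth P' i \mPo G) = H' ^+ e * tnth P i.
  by rewrite -(inverse_pair_comp FG (hP i)) E rmorphM.
have [||g gE] := @same_map_scale K k (comp_coords P' G) P _ cP.
- by exists l.
- move=> i j; rewrite !tnth_mktuple; apply: (mulfI hG0).
  by rewrite !mulrA !E' mulrAC.
have {}E' : (h \mPo G) * g = H' ^+ e.
  apply: (mulIf Pl); rewrite -E' -mulrA; congr (_ * _).
  by rewrite -gE tnth_mktuple.
(* Compute F_m0 o G o F in two ways and cancel F_m0. *)
have H'F : H' \mPo F = H ^+ d.
  have Fm0F : 'X_m0 \mPo F != 0 by rewrite comp_mpolyXU -tnth_nth.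
  apply: (mulIf Fm0); have := inverse_pair_comp GF (hF m0) => <-.
  have [_ _ _ _ ->] := FG; rewrite rmorphM /= comp_mpolyXU -tnth_nth.
  by [].
have := congr1 (fun p => p \mPo F) E'.
rewrite rmorphM rmorphXn /= H'F (inverse_pair_comp GF hr) -exprM => <-.
by exists (H ^+ r * (g \mPo F)); rewrite mulrAC.
Qed.
End Iterates.

(** * Growth of chi_F *)

Section ChiGrowth.
Local Open Scope nat_scope.

Lemma iter_chi_Phi_ge d k D m c : c ^ (2 ^ m) <= iter m (chi_Phi d k D) c.
Proof.
elim: m => [|m IH]; first by rewrite expn0 expn1.
rewrite iterS /chi_Phi; apply: (@leq_trans ((c ^ (2 ^ m)) ^ 2)).
  by rewrite -expnM -expnSr.
by rewrite -[X in X <= _]mul1n leq_mul ?chi_q_gt0 // leq_exp2r.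
Qed.

Lemma chi_F_expn d k D i :
  chi_F d k D i ^ (2 ^ chi_F d k D i) <= chi_F d k D i.+1.
Proof. exact: iter_chi_Phi_ge. Qed.

Lemma chi_F_mono d k D i : chi_F d k D i <= chi_F d k D i.+1.
Proof.
apply: leq_trans (chi_F_expn _ _ _ _).
by rewrite -[X in X <= _]expn1 leq_pexp2l ?chi_F_gt0 ?expn_gt0.
Qed.

(** The left side counts the letters: a degree below D, and one bit for each of s prime factors of
    H^(dD). *)
Lemma chi_F0_ge d k D s : 1 < d -> d < D ->
  s <= d * D * (d * (k * d.+1 ^ k)) -> D * 2 ^ s <= 2 ^ chi_F d k D 0.
Proof.
move=> d1 dD hs; have D0 : 0 < D by apply: leq_trans dD.
apply: (@leq_trans (2 ^ (D + s))).
  by rewrite expnD leq_mul2r ltnW ?orbT // ltn_expl.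
(* A dominates both D and s, while 2A = (2D)^(k+1) D^2 is at most F_1, because q is at least
   (2D)^(k+1) once d > 1. *)
rewrite leq_exp2l //=; set A := D ^ k * D ^ 3 * 2 ^ k.
have A0 : D <= A.
  rewrite /A -mulnA mulnCA expnS -mulnA.
  by rewrite leq_pmulr // !muln_gt0 !expn_gt0 D0.
have sA : s <= A.
  apply: leq_trans hs _.
  have -> : d * D * (d * (k * d.+1 ^ k)) = d.+1 ^ k * (d * D * d) * k.
    by move: (d.+1 ^ k) => e; ring.
  apply: leq_mul; last by apply: ltnW; apply: ltn_expl.
  apply: leq_mul; first by case: (k) => // k'; rewrite leq_exp2r.
  have -> : D ^ 3 = D * D * D by rewrite !expnS expn0; ring.
  by rewrite !leq_mul // ltnW.
apply: (@leq_trans (2 * A)); first by rewrite mul2n -addnn leq_add.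
have qA : D ^ k.+1 * 2 ^ k.+1 <= chi_q d k D.
  rewrite /chi_q -expnMn addn1 addn1; apply: (@leq_trans ((d * D).+1 ^ k.+1)).
    by rewrite leq_exp2r // mulnC ltnW // ltnS leq_mul2r d1 orbT.
  by rewrite leq_pexp2l // leq_pmull // subn_gt0.
apply: (@leq_trans (D ^ k.+1 * 2 ^ k.+1 * D ^ 2)); last first.
  by apply: leq_mul qA _; rewrite leq_exp2r // addn1.
rewrite /A !expnS expn0; move: (D ^ k) (2 ^ k) => a b.
by rewrite leq_eqVlt; apply/orP; left; apply/eqP; ring.
Qed.

Lemma ltn_expn_tower f q : 3 <= f -> q <= 2 ^ f -> q < f ^ (2 ^ f).
Proof.
move=> f3 hq; have f1 : 1 < f by apply: ltnW.
apply: (@leq_trans (2 ^ f.+1)).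
  by rewrite expnS mul2n -addnn -addn1 leq_add // expn_gt0.
apply: (@leq_trans (f ^ f.+1)); first by rewrite leq_exp2r.
by rewrite leq_pexp2l ?(ltnW f1) //; apply: ltn_expl.
Qed.

Lemma expn_tower_ge f q : 3 <= f -> q <= f -> (q ^ f).+1 * f <= f ^ (2 ^ f).
Proof.
move=> f3 qf; have f0 : 0 < f by apply: leq_trans f3.
have two m : 3 <= m -> m + 2 <= 2 ^ m.
  elim: m => // m IH; rewrite leq_eqVlt => /orP[/eqP <- //|/IH le].
  by rewrite expnS mul2n -addnn addSn -addn1 leq_add // expn_gt0.
apply: (@leq_trans (f ^ (f + 2))); last by rewrite leq_pexp2l // two.
have qff : q ^ f <= f ^ f by rewrite leq_exp2r.
have ff : 0 < f ^ f by rewrite expn_gt0 f0.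
rewrite expnD -mulnn mulnA leq_mul2r; apply/orP; right.
apply: (@leq_trans (f ^ f * 2)); last by rewrite leq_mul2l ltnW ?orbT.
by rewrite muln2 -addnn -addn1 leq_add.
Qed.

Lemma chi_F_ge3 d k D i : 1 < D -> 3 <= chi_F d k D i.
Proof.
move=> D1; elim: i => [|i IH]; last exact: leq_trans IH (chi_F_mono _ _ _ _).
apply: (@leq_trans (1 * (D + 1) ^ 2)); last by rewrite leq_mul ?chi_q_gt0.
by rewrite mul1n (@leq_trans (3 ^ 2)) // leq_exp2r // addn1.
Qed.

(** The lengths F_2, F_3, ... satisfy the growth condition of [sesquipower_factor] for q letters:
    F_2 already exceeds q, and F_{i+1} is at least f^(2^f) for f = F_i. *)
Lemma chi_F_pigeonhole d k D q i : 1 < D -> q <= 2 ^ chi_F d k D 0 ->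
  (q ^ chi_F d k D i.+1).+1 * chi_F d k D i.+1 <= chi_F d k D i.+2
  /\ q < chi_F d k D 1.
Proof.
move=> D1 hq; have q1 : q < chi_F d k D 1.
  apply: leq_trans (chi_F_expn _ _ _ _); apply: ltn_expn_tower hq.
  exact: chi_F_ge3.
split=> //; apply: leq_trans (chi_F_expn _ _ _ _).
apply: expn_tower_ge; first exact: chi_F_ge3.
elim: i => [|i IH]; first exact: ltnW.
exact: leq_trans IH (chi_F_mono _ _ _ _).
Qed.

Lemma chi_F_lt_S d k D i j : i < j -> chi_F d k D i < chi_S d k D j.
Proof.
move=> lt; rewrite /chi_S add1n ltnS (bigD1 (Ordinal lt)) //=.
exact: leq_addr.
Qed.

(** By Pascal's rule the two binomials differ by C(k+D-1, k-1), which exceeds D and so is at least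
    3. *)
Lemma bin_pred_lt k D : 1 < k -> 1 < D ->
  'C(D.-1 + k, D.-1) < 'C(k + D, k) - 2.
Proof.
case: k => // -[|k] // _; case: D => // D D0 /=.
have hb m l : m < 'C(l.+1 + m, l.+1).
  elim: m => [|m IH]; first by rewrite addn0 binn.
  rewrite addnS binS -addn1; apply: leq_add => //.
  by rewrite bin_gt0 addSnnS leq_addr.
rewrite -(bin_sub (leq_addr _ _)) addKn [k.+2 + _]addnS binS [D + _]addnC.
have := hb D.+1 k; rewrite -addSnnS; set b := 'C(_, k.+1); lia.
Qed.

End ChiGrowth.

(** * Boundedness of the degrees *)

Section Boundedness.
Variables (K : fieldType) (k : nat).
Implicit Types (f F G : coords K k) (h : {mpoly K[k.+1]}).

Lemma msize_expS h m : h != 0 -> msize (h ^+ m) = ((msize h).-1 * m).+1.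
Proof.
move=> h0; have hh : msize h = (msize h).-1.+1.
  by rewrite prednK // lt0n msize_poly_eq0.
elim: m => [|m IH]; first by rewrite muln0 msize1.
by rewrite exprS msizeM ?expf_neq0 // IH {1}hh mulnS !addSn addnS.
Qed.

Lemma inverse_pair_msize F G d d' H H' :
  inverse_pair F G d d' H H' -> (msize H <= d * d')%N.
Proof.
case=> -[[_ hF] [_ hG]] _ [H0 _] GF _.
have X0 := @mpolyX_neq0 K k.+1 ord0.
have hX : ('X_ord0 : {mpoly K[k.+1]}) \is 1%N.-homog.
  by rewrite dhomogX; apply/eqP/mdeg1.
have := msizeM_homog H0 X0 hX; rewrite -GF (@msize_homog _ _ (d' * d)).
- by rewrite addn1 mulnC => -[<-].
- by rewrite GF mulf_neq0.
exact: comp_mpoly_homog.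
Qed.

(** H^(dN) is factored once for all: every cofactor coming from coordinates of degree at most N
    divides it, hence is a subproduct of one fixed list, up to a constant. *)
Lemma color_decomposition F G d d' H H' (N : nat) :
  inverse_pair F G d d' H H' ->
  exists s : seq {mpoly K[k.+1]}, (size s <= d * N * (d * d'))%N /\
    forall e P P' e' h, (e <= N)%N -> homog_coords e P -> no_common_factor P ->
      homog_coords e' P' -> h != 0 ->
      (forall i, tnth P i \mPo F = h * tnth P' i) ->
      exists (m : (size s).-tuple bool) (a : K),
        h = a *: \prod_(p <- mask m s) p.
Proof.
move=> FG; have [_ _ [H0 _] _ _] := FG.
have [s hs] := factorial_mpoly (expf_neq0 (d * N) H0).
exists s; split.
  have := size_prime_factors hs; rewrite msize_expS // ltnS.
  move/leq_trans; apply.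
  rewrite mulnC leq_mul2l; apply/orP; right.
  by apply: leq_trans (leq_pred _) (inverse_pair_msize FG).
move=> e P P' e' h eN hP cP hP' h0 E.
have [q qE] := cofactor_divides FG hP cP hP' h0 E.
have hHN : H ^+ (d * N) = h * (q * H ^+ (d * (N - e))).
  by rewrite mulrA [h * q]mulrC -qE -exprD -mulnDr subnKC.
rewrite hHN in hs; have [m [/eqP sm [_ [u uu hE]] _]] := prime_factors_split hs.
exists (Tuple sm), (u@_0); rewrite hE -mul_mpolyC; congr (_ * _).
by apply: msize1_polyC; move: uu; rewrite mpoly_unitE => /eqP->.
Qed.

Section Orbit.
Variables (f F G : coords K k) (d d' : nat) (H H' c : {mpoly K[k.+1]}).
Hypotheses (bf : birational f) (FG : inverse_pair F G d d' H H').
Hypothesis fE : forall i, tnth f i = c * tnth F i.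

Lemma degree_iterateS j :
  (degree (iterate f j.+1) <= degree (iterate f j) * d)%N.
Proof.
have [P [h PP]] := iterate_recurrence bf FG fE.
have [[[l Pl] hP] _ _ _ E] := PP j; have [[nz _] _ _ sP _] := PP j.+1.
have [[_ hF] _] : homog_coords d F /\ homog_coords d' G by case: FG.
apply: (@degree_le _ _ _ (comp_coords (P j) F)).
- exact: rational_iterate.
- split=> [|i]; last by rewrite tnth_mktuple; exact: comp_mpoly_homog.
  by exists l; rewrite tnth_mktuple; exact: inverse_pair_neq0 FG (hP l) Pl.
apply: same_map_trans nz sP (same_map_sym _).
by apply: (scale_same_map (h := h j)) => i; rewrite tnth_mktuple.
Qed.

Lemma degree_iterateD i j :
  (degree (iterate f (i + j)) <= degree (iterate f i) * d ^ j)%N.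
Proof.
elim: j => [|j IH]; first by rewrite addn0 muln1.
rewrite addnS expnSr mulnA; apply: leq_trans (degree_iterateS _) _.
by rewrite leq_mul2r IH orbT.
Qed.

(** The m-fold pullback of P_i is nonzero and a multiple of both P_{i+m} and Q, so Q is a coordinate
    system for the iterate of order i + m. *)
Lemma degree_returns P (h : nat -> {mpoly K[k.+1]}) i m e g (Q : coords K k) :
  reduced_orbit f F P h ->
  (forall l, tnth Q l \is e.-homog) ->
  (forall l, iter m (fun q => q \mPo F) (tnth (P i) l) = g * tnth Q l) ->
  (degree (iterate f (i + m)) <= e)%N.
Proof.
move=> PP hQ QE.
have [[_ hF] _] : homog_coords d F /\ homog_coords d' G by case: FG.
have [g' PE] : exists g', forall l,
    iter m (fun q => q \mPo F) (tnth (P i) l) = g' * tnth (P (i + m)%N) l.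
  elim: m {QE} => [|m [g' IH]]; first by exists 1 => l; rewrite addn0 mul1r.
  have [_ _ _ _ E] := PP (i + m)%N.
  exists ((g' \mPo F) * h (i + m)%N) => l.
  by rewrite iterS IH rmorphM /= E mulrA addnS.
have [[[l Pl] hP] _ _ _ _] := PP i.
have [nz _] : iter m (fun q => q \mPo F) (tnth (P i) l) != 0 /\
    iter m (fun q => q \mPo F) (tnth (P i) l)
      \is (degree (iterate f i) * d ^ m).-homog.
  elim: m {QE PE} => [|m [nz hm]].
    by rewrite muln1; split; [exact: Pl | exact: hP].
  rewrite iterS expnSr mulnA; split; first exact: inverse_pair_neq0 FG hm nz.
  exact: comp_mpoly_homog.
have g'0 : g' != 0 by apply: contraNneq nz => z; rewrite PE z mul0r.
have g0 : g != 0 by apply: contraNneq nz => z; rewrite QE z mul0r.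
have PQ : same_map (P (i + m)%N) Q.
  move=> a b; apply: (mulfI (mulf_neq0 g'0 g0)).
  by rewrite [LHS]mulrACA [RHS]mulrACA -!QE !PE mulrC.
have [[nzP _] _ _ sP _] := PP (i + m)%N.
apply: (@degree_le _ _ _ Q); first exact: rational_iterate.
  by split=> //; exists l; apply: contraNneq nz => z; rewrite QE z mulr0.
exact: same_map_trans nzP sP PQ.
Qed.

End Orbit.

Lemma iterate1 f : iterate f 1 = f.
Proof. by apply: eq_from_tnth => i; rewrite tnth_mktuple comp_mpoly_id. Qed.

Lemma degree_periodic_bounded f F G d d' H H' c i t e :
  birational f -> inverse_pair F G d d' H H' ->
  (forall i, tnth f i = c * tnth F i) -> (0 < t)%N ->
  (forall s, degree (iterate f (i + s * t)) <= e)%N ->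
  exists B, forall m, (degree (iterate f m) <= B)%N.
Proof.
move=> bf FG fE t0 he.
(* Beyond i, fewer than t steps separate m from the last index i + s t below it. The base d + 1
   keeps the power monotone even for d = 0. *)
exists ((degree (iterate f 0) + e) * d.+1 ^ (i + t))%N => m.
have powS a b : (a <= b -> d ^ a <= d.+1 ^ b)%N.
  move=> ab; apply: (@leq_trans (d.+1 ^ a)); last by rewrite leq_pexp2l.
  by case: (a) => // a'; rewrite leq_exp2r.
have [lt|le] := ltnP m i.
  have := degree_iterateD bf FG fE 0 m; rewrite add0n => /leq_trans; apply.
  by rewrite leq_mul ?leq_addr // powS // ltnW // (leq_trans lt) // leq_addr.
rewrite -(subnKC le) (divn_eq (m - i) t) addnA.
apply: leq_trans (degree_iterateD bf FG fE _ _) _.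
apply: leq_mul; first exact: leq_trans (he _) (leq_addl _ _).
by apply: powS; apply: leq_trans (leq_addl _ _); apply: ltnW; rewrite ltn_mod.
Qed.

Lemma degree_le1_bounded f F G d d' H H' c : (d <= 1)%N ->
  birational f -> inverse_pair F G d d' H H' ->
  (forall i, tnth f i = c * tnth F i) ->
  exists B, forall m, (degree (iterate f m) <= B)%N.
Proof.
move=> d1 bf FG fE; exists (degree (iterate f 0)) => m.
have := degree_iterateD bf FG fE 0 m; rewrite add0n => /leq_trans; apply.
rewrite -[X in (_ <= X)%N]muln1 leq_mul //.
move: d1; rewrite leq_eqVlt ltnS leqn0 => /orP[]/eqP->.
  by rewrite exp1n.
by case: (m) => // m'; rewrite exp0n.
Qed.

Lemma slow_degrees_bounded f n D : (0 < k)%N -> birational f ->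
  chi_adm (degree f) k n D ->
  (forall j, (j <= n)%N -> (degree (iterate f j) < D)%N) ->
  exists B, forall m, (degree (iterate f m) <= B)%N.
Proof.
move=> k0 bf /andP[D0 hS] slow.
have [F [G [d' [H [H' [c [FG fE]]]]]]] := birational_inverse_pair k0 bf.
set d := degree f in hS FG.
have [d1|d1] := leqP d 1; first exact: degree_le1_bounded d1 bf FG fE.
have dD : (d < D)%N.
  by have := slow 1%N; rewrite iterate1; apply; apply: leq_trans hS.
(* On the line, the bound for the inverse applied to the swapped pair gives d <= 1. *)
have k1 : (1 < k)%N.
  rewrite ltn_neqAle k0 andbT; apply: contraTneq d1 => k1.
  by rewrite -leqNgt (inverse_degree_line (esym k1) (inverse_pair_sym FG)).
have D1 : (1 < D)%N by apply: leq_trans (ltnW dD).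
have [s [ss dec]] := color_decomposition D FG.
have [P [h PP]] := iterate_recurrence bf FG fE.
set C : finType := ('I_D * (size s).-tuple bool)%type.
(* Past n the letter is an arbitrary default. *)
have colP j : exists x : C, (j <= n)%N -> val x.1 = degree (iterate f j) /\
    exists a : K, h j = a *: \prod_(p <- mask x.2 s) p.
  have [le|] := leqP j n; last first.
    by exists (Ordinal D0, [tuple of nseq (size s) true]).
  have [hP cP h0 _ E] := PP j; have [hP' _ _ _ _] := PP j.+1.
  have [m mE] := dec _ _ _ _ _ (ltnW (slow _ le)) hP cP hP' h0 E.
  by exists (Ordinal (slow _ le), m).
pose col j := proj1_sig (constructive_indefinite_description _ (colP j)).
have colE j : (j <= n)%N -> val (col j).1 = degree (iterate f j) /\
    exists a : K, h j = a *: \prod_(p <- mask (col j).2 s) p.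
  by rewrite /col; case: constructive_indefinite_description.
have card_C : (#|C| <= 2 ^ chi_F d k D 0)%N.
  rewrite /C card_prod card_ord card_tuple card_bool.
  apply: chi_F0_ge => //; apply: leq_trans ss _.
  by rewrite !leq_mul // (inverse_degree_exp FG).
(* The lengths are 1, F_2, F_3, ...; F_1 is left out, since it only bounds the logarithm of the size
   of the alphabet. *)
pose len i := if i is 0%N then 1%N else chi_F d k D i.
have lenS i : ((#|C| ^ len i).+1 * len i <= len i.+1)%N.
  case: i => [|i] /=; last by have [] := chi_F_pigeonhole i D1 card_C.
  by rewrite muln1; have [] := chi_F_pigeonhole 0 D1 card_C.
(* The dimension of the space of forms of degree D - 1, the largest degree that occurs. *)
set r := 'C(D.-1 + k, D.-1).
have rn : (len r <= n)%N.
  (* The required length is at most F_{r+1}, a single term of the sum S, which is below n. *)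
  apply: leq_trans (ltnW hS); apply: (@leq_trans (chi_F d k D r)).
    by rewrite /len; case: (r) => // ; exact: chi_F_gt0.
  by apply/ltnW/chi_F_lt_S; exact: bin_pred_lt.
have homP j : (j < n)%N -> homog_coords (val (col j).1) (P j).
  by move=> lt; have [-> _] := colE j (ltnW lt); have [] := PP j.
have stepP j : (j < n)%N -> exists a : K, forall l, tnth (P j) l \mPo F =
    a *: (\prod_(p <- mask (col j).2 s) p * tnth (P j.+1) l).
  move=> lt; have [_ [a aE]] := colE j (ltnW lt); exists a => l.
  by have [_ _ _ _ ->] := PP j; rewrite aE scalerAl.
have dimP (x : C) : ('C(val x.1 + k, val x.1) <= r)%N.
  rewrite -(bin_sub (leq_addr _ _)) addKn /r -(bin_sub (leq_addr k _)) addKn.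
  by apply: leq_bin2l; rewrite leq_add2r -ltnS prednK // ltn_ord.
have nzP j : exists l, tnth (P j) l != 0 by have [[]] := PP j.
have [i [t [lt t0 ret]]] := @recurrence_returns K k F P C col (fun x => val x.1)
  (fun x => \prod_(p <- mask x.2 s) p) n r homP stepP dimP len isT lenS rn nzP.
apply: (degree_periodic_bounded (i := i) (e := val (col i).1) bf FG fE t0) => q.
have [g [Q [hQ QE]]] := ret q.
exact: (degree_returns bf FG PP hQ QE).
Qed.

End Boundedness.

Theorem theoremC (K : fieldType) (k : nat) (hk : (1 <= k)%N)
    (f : coords K k) (hf : birational f)
    (d : nat) (hd : degree f = d)
    (hunb : forall B : nat, exists n : nat, (B < max_degree f n)%N) :
  forall n : nat, (chi d k n <= max_degree f n)%N.
Proof.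
move=> n; rewrite leqNgt; apply/negP => lt.
have [_ [adm|[c0 _]]] := chi_max d n hk; last by rewrite c0 in lt.
rewrite -hd in adm lt.
have [|B hB] := slow_degrees_bounded hk hf adm.
  move=> j le; apply: leq_ltn_trans lt; rewrite /max_degree.
  pose j' := Ordinal (le : j < n.+1)%N.
  exact: (leq_bigmax (F := fun j : 'I_n.+1 => degree (iterate f j)) j').
have [m] := hunb B; rewrite ltnNge; case/negP.
by apply/bigmax_leqP => j _; exact: hB.
Qed.
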